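(* There is a universal constant $C>0$ such that for every $2\le p<\infty$, every integer $\lambda\ge 2$, every subset $\mathcal D$ of $L_p$ that is $\lambda$-doubling, and every Banach space $(\mathbf Z,\|\cdot\|_{\mathbf Z})$, $$e(L_p,\mathcal D;\mathbf Z)\le C\big(p^2\sqrt{\log p}\big)\sqrt{\log\lambda}.$$
   Context: $L_p$ denotes the real Banach space $L_p([0,1])$ with Lebesgue measure. For an integer $\lambda\ge2$, a metric space $(\mathcal M,d)$ is $\lambda$-doubling if for every $r\ge0$ and $x\in\mathcal M$ there are $y_1,\dots,y_\lambda\in\mathcal M$ with $B_{\mathcal M}(x,2r)\subseteq B_{\mathcal M}(y_1,r)\cup\dots\cup B_{\mathcal M}(y_\lambda,r)$, where $B_{\mathcal M}(u,\rho)=\{v\in\mathcal M: d(u,v)\le\rho\}$ is the closed ball; a subset is $\lambda$-doubling if it is so as a metric space with the restricted metric. For a metric space $(\mathcal M,d_{\mathcal M})$, a subset $\mathcal C\subseteq\mathcal M$ with $|\mathcal C|\ge 2$ and a metric space $(\mathcal T,d_{\mathcal T})$, $e(\mathcal M,\mathcal C;\mathcal T)$ denotes the infimum over those $K>0$ such that every $f:\mathcal C\to\mathcal T$ has an extension $F:\mathcal M\to\mathcal T$ with $\|F\|_{\mathrm{Lip}(\mathcal M;\mathcal T)}\le K\|f\|_{\mathrm{Lip}(\mathcal C;\mathcal T)}$ (vacuous when $f$ is not Lipschitz), where $\|\cdot\|_{\mathrm{Lip}}$ is the Lipschitz constant. *)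

(* Defs.v *)
From HB Require Import structures.
From mathcomp Require Import all_boot all_order all_algebra.
From mathcomp Require Import all_classical all_reals all_analysis.
From mathcomp Require Import measurable_realfun.

Set Implicit Arguments.
Unset Strict Implicit.
Unset Printing Implicit Defensive.

Import Order.TTheory GRing.Theory Num.Theory.
Import numFieldNormedType.Exports.

Local Open Scope classical_set_scope.
Local Open Scope ring_scope.

(* [LspaceType] consists of classes of functions modulo equality mu-almost
   everywhere and comes without a metric; the coercion to functions picks a
   representative, whose choice does not affect the norm. *)
Section Lspace_metric.
Context d (T : measurableType d) (R : realType).
Variables (mu : {measure set T -> \bar R}) (p : \bar R) (p1 : (1 <= p)%E).
Local Notation aeclass := (aeEqMfun (T1 := T) (measurableTypeR R) mu).
Implicit Types f g h : LspaceType mu p1.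

HB.instance Definition _ := gen_eqMixin (LspaceType mu p1).
HB.instance Definition _ := gen_choiceMixin (LspaceType mu p1).

Definition Lspace_dist f g : R :=
  fine 'N[mu]_p[EFin \o ((f : T -> R) \- (g : T -> R))%R].

Local Lemma mLspace f : measurable_fun [set: T] (f : T -> R).
Proof. exact: (@measurable_funPT _ _ _ _ (repr (f : aeclass))). Qed.

Local Lemma Lspace_dist_fin f g :
  ('N[mu]_p[EFin \o ((f : T -> R) \- (g : T -> R))%R] < +oo)%E.
Proof.
have Lf : (f : T -> R) \in Lfun mu p.
  by apply/andP; split; rewrite inE; [exact: mLspace|exact: Lebesgue_finite].
have Lg : (g : T -> R) \in Lfun mu p.
  by apply/andP; split; rewrite inE; [exact: mLspace|exact: Lebesgue_finite].
have : (f : T -> R) \- (g : T -> R) \in Lfun mu p.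
  have -> : (f : T -> R) \- (g : T -> R) =
      val ((Lfun_Sub p1 Lf : LfunType mu p1) - Lfun_Sub p1 Lg) by [].
  exact: LfunP.
by move=> /andP[_]; rewrite inE.
Qed.

Local Lemma Lspace_distE f g :
  (Lspace_dist f g)%:E = ('N[mu]_p[EFin \o ((f : T -> R) \- (g : T -> R))%R])%E.
Proof.
by rewrite /Lspace_dist fineK// fin_numElt (lt_le_trans ltNy0)
  ?Lnorm_ge0//= Lspace_dist_fin.
Qed.

Local Lemma Lspace_distxx f : Lspace_dist f f = 0.
Proof.
rewrite /Lspace_dist (_ : EFin \o _ = cst 0%E); last first.
  by apply/funext => x /=; rewrite subrr.
by rewrite Lnorm0// gt_eqF// (lt_le_trans _ p1).
Qed.

Local Lemma Lspace_dist_sym f g : Lspace_dist f g = Lspace_dist g f.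
Proof.
rewrite /Lspace_dist -(oppe_Lnorm mu); congr (fine (Lnorm _ _ _)).
by apply/funext => x /=; rewrite opprB.
Qed.

Local Lemma Lspace_dist_triangle g f h :
  Lspace_dist f h <= Lspace_dist f g + Lspace_dist g h.
Proof.
rewrite -lee_fin EFinD !Lspace_distE.
have mfg : measurable_fun [set: T] ((f : T -> R) \- (g : T -> R)).
  by apply: measurable_funB; exact: mLspace.
have mgh : measurable_fun [set: T] ((g : T -> R) \- (h : T -> R)).
  by apply: measurable_funB; exact: mLspace.
apply: le_trans (eminkowski mu mfg mgh p1).
rewrite le_eqVlt; apply/orP; left; apply/eqP; congr (Lnorm _ _ _).
by apply/funext => x /=; rewrite addrA subrK.
Qed.

Local Lemma Lspace_dist_eq0 f g : Lspace_dist f g = 0 -> f = g.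
Proof.
move=> fg0.
have : ('N[mu]_p[EFin \o ((f : T -> R) \- (g : T -> R))%R] = 0)%E
  by rewrite -Lspace_distE fg0.
have /measurable_EFinP mfg :
    measurable_fun [set: T] ((f : T -> R) \- (g : T -> R)).
  by apply: measurable_funB; exact: mLspace.
move/(Lnorm_eq0_eq0 mfg (lt_le_trans lte01 p1)) => fg.
have fgq : (f : aeclass) = g.
  rewrite -(reprK (f : aeclass)) -(reprK (g : aeclass)).
  apply/eqmodP/asboolP; apply: filterS fg => x /= /(_ I) [/eqP].
  by rewrite subr_eq0 => /eqP.
move: f g fgq {fg0 fg mfg} => [f [[Pf]]] [g [[Pg]]] /= fgq.
by subst g; rewrite (Prop_irrelevance Pf Pg).
Qed.

HB.instance Definition _ := @isMetric.Build R (LspaceType mu p1) Lspace_dist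
  Lspace_distxx Lspace_dist_eq0 Lspace_dist_sym Lspace_dist_triangle.

End Lspace_metric.

(* The restriction of Lebesgue measure to [0, 1]: functions that agree almost
   everywhere on [0, 1] are identified, whatever their values elsewhere. *)
Definition lebesgue01 (R : realType) :
    {measure set (measurableTypeR R) -> \bar R} :=
  mrestr (@lebesgue_measure R) (measurable_itv `[0, 1]%R).

Definition Lp01 (R : realType) (p : R) (p1 : (1 <= p%:E)%E) : metricType R :=
  LspaceType (lebesgue01 R) p1.

Lemma Lp01_exponent (R : realType) (p : R) : 2 <= p -> (1 <= p%:E)%E.
Proof. by move=> p2; rewrite lee_fin (le_trans _ p2)// ler1n. Qed.

Section set_type_metric.
Context (R : realType) (M : metricType R) (A : set M).

Definition set_type_dist (x y : set_type A) : R := mdist (val x) (val y).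

Local Lemma set_type_dist_ge0 x y : 0 <= set_type_dist x y.
Proof. exact: mdist_ge0. Qed.

Local Lemma set_type_dist_eq0 x y : set_type_dist x y = 0 -> x = y.
Proof. by move=> /mdist_positivity /val_inj. Qed.

Local Lemma set_type_ballE (x : set_type A) e :
  ball x e = [set y | set_type_dist x y < e].
Proof. by rewrite -[LHS]/(set_val @^-1` ball (set_val x) e) ballEmdist. Qed.

HB.instance Definition _ := @PseudoMetric_isMetric.Build R (set_type A)
  set_type_dist set_type_dist_ge0 set_type_dist_eq0 set_type_ballE.

End set_type_metric.

Definition normmetric (R : realType) (V : normedModType R) : Type := V.

Section normmetric_metric.
Context (R : realType) (V : normedModType R).

HB.instance Definition _ := PseudoMetric.on (normmetric V).

Definition normmetric_dist (x y : normmetric V) : R := `|(x : V) - (y : V)|.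

Local Lemma normmetric_dist_ge0 x y : 0 <= normmetric_dist x y.
Proof. exact: normr_ge0. Qed.

Local Lemma normmetric_dist_eq0 x y : normmetric_dist x y = 0 -> x = y.
Proof. by move=> /normr0_eq0/eqP; rewrite subr_eq0 => /eqP. Qed.

Local Lemma normmetric_ballE (x : normmetric V) e :
  ball x e = [set y | normmetric_dist x y < e].
Proof. by rewrite -[LHS]/(@ball R V x e) -ball_normE. Qed.

HB.instance Definition _ := @PseudoMetric_isMetric.Build R (normmetric V)
  normmetric_dist normmetric_dist_ge0 normmetric_dist_eq0 normmetric_ballE.

End normmetric_metric.

(* Not the library's [closed_ball], which is the closure of the open ball: in
   a general metric space that can be smaller, and it is empty for r = 0. *)
Definition mcball (R : realType) (M : metricType R) (u : M) (r : R) : set M :=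
  [set v | mdist u v <= r].

Definition doubling (R : realType) (lam : nat) (M : metricType R) : Prop :=
  forall (r : R) (x : M), 0 <= r ->
    exists y : 'I_lam -> M,
      mcball x (2 * r) `<=` \bigcup_(i in [set: 'I_lam]) mcball (y i) r.

(* Equal to +oo when f is not Lipschitz. *)
Definition Lip (R : realType) (X Y : metricType R) (f : X -> Y) : \bar R :=
  ereal_inf [set L%:E | L in [set L : R |
    0 <= L /\ forall x y, mdist (f x) (f y) <= L * mdist x y]].

(* The Lipschitz extension modulus e(M, C; T).  For f not Lipschitz the bound
   reads Lip F <= K%:E * +oo = +oo, which is no constraint since K > 0. *)
Definition ext_modulus (R : realType) (M : metricType R) (C : set M)
    (T : metricType R) : \bar R :=
  ereal_inf [set K%:E | K in [set K : R |
    0 < K /\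
    forall f : set_type C -> T, exists F : M -> T,
      (forall c : set_type C, F (val c) = f c) /\
      (Lip F <= K%:E * Lip f)%E]].

(* Main.v *)
(* The extension is a Whitney-type average: near D at distance s, F is a convex
   combination of values of f, with weights whose l_1 variation is controlled.
   In Hilbert space N points admit such weights at scale delta with variation
   O(sqrt (log N) / delta): project randomly to dimension O(log N) and use the
   square of an l_2-valued Lipschitz tensor product on a cubic lattice.

   In L_p one works on a ball of radius Dl, rescaled to the unit ball, where the
   Mazur map |u|^(p/2) sgn u into L_2 is p-Lipschitz.  If the images of u and v
   are within a small constant, then v - u / p has norm at most 1 - c / p.  So a
   Hilbert space partition at a constant scale splits the ball into cells of
   radius (1 - c / p) Dl, at the cost p sqrt (log p log lam) / Dl.  Iterating
   from a huge radius, where a crude partition is affordable, down to radius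
   about p s, the costs form a geometric series with sum
   p^2 sqrt (log p log lam) / (p s), while f oscillates by O(p s) on the final
   cells. *)

Require Import Defs.
From mathcomp Require Import all_boot all_order all_algebra.
From mathcomp Require Import all_classical all_reals all_analysis.
From mathcomp Require Import measurable_realfun.
From mathcomp Require Import ring lra zify.

Set Implicit Arguments.
Unset Strict Implicit.
Unset Printing Implicit Defensive.

Import Order.TTheory GRing.Theory Num.Theory.
Import numFieldNormedType.Exports.

Local Open Scope classical_set_scope.
Local Open Scope ring_scope.

(** * Random signs and small balls *)

(** The obstacle is that the inverse of the Mazur map is far from Lipschitz, so small cells in
    Hilbert space do not pull back to proportionally small cells. Closeness at a constant scale only
    yields the factor 1 - c / p, and that only after the centre has been moved by the fraction 1 / p
    towards a point of the cell. About p successive radii are thus spent on halving a scale. This is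
    affordable because the costs add instead of multiplying: all local functions stay within O(p s)
    of f at one common nearby point of D, so a change of weights is always multiplied by O(p s),
    whatever the current radius. The radius occurs only in the variation of the weights. Only points
    within s of D are partitioned, so all nets are nets of D, and the doubling constant enters
    through their cardinality. The random projections have a finite sample space of signs, which
    turns every expectation into a finite sum. The argument runs on functions, with a seminorm and a
    semidefinite form; classes modulo equality almost everywhere return only at the end. *)

Section SignFunctionals.
Context (R : realType) (H : lmodType R).
Implicit Types (b : H -> H -> R) (h x y z : H).

(** Semidefinite, because it stands for the L_2 inner product on functions, where a function that
    vanishes almost everywhere has norm 0. *)
Definition psd_form b :=
  [/\ forall x y z, b (x + y) z = b x z + b y z,
      forall a x z, b (a *: x) z = a * b x z,
      forall x y, b x y = b y x &
      forall x, 0 <= b x x].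

Lemma psd_cauchy_schwarz b x y : psd_form b -> b x y ^+ 2 <= b x x * b y y.
Proof.
case=> bD bZ bC b0.
have q t : 0 <= b x x + 2 * t * b x y + t ^+ 2 * b y y.
  have := b0 (x + t *: y).
  rewrite bD bZ (bC x) (bC y) !bD !bZ (bC y x).
  by move/le_trans; apply; rewrite le_eqVlt; apply/orP; left; apply/eqP; ring.
have [y0|y0] := eqVneq (b y y) 0; last first.
  have yp : 0 < b y y by rewrite lt_neqAle eq_sym y0 b0.
  have := q (- b x y / b y y).
  rewrite -(pmulr_rge0 _ yp).
  have -> : b y y * (b x x + 2 * (- b x y / b y y) * b x y +
     (- b x y / b y y) ^+ 2 * b y y) = b x x * b y y - b x y ^+ 2 by field.
  by rewrite subr_ge0.
have [->|xy0] := eqVneq (b x y) 0; first by rewrite expr0n mulr_ge0.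
(* With [b y y] = 0 the quadratic is affine in t, and this t gives it the value -1. *)
have := q (- (b x x + 1) / (2 * b x y)).
rewrite y0 mulr0 addr0.
have -> : b x x + 2 * (- (b x x + 1) / (2 * b x y)) * b x y = - 1 by field.
by rewrite lerNr oppr0 ler10.
Qed.

Lemma psd_triangle b x y : psd_form b ->
  Num.sqrt (b (x + y) (x + y)) <= Num.sqrt (b x x) + Num.sqrt (b y y).
Proof.
move=> bP; have [bD bZ bC b0] := bP.
rewrite -ler_sqr ?nnegrE ?addr_ge0 ?sqrtr_ge0// sqrrD !sqr_sqrtr//.
rewrite bD (bC x) (bC y) !bD (bC y x).
have : b x y <= Num.sqrt (b x x) * Num.sqrt (b y y).
  rewrite -sqrtrM//; apply: le_trans (ler_norm _) _.
  by rewrite -sqrtr_sqr ler_wsqrtr// psd_cauchy_schwarz.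
by rewrite -mulr_natr; lra.
Qed.

Lemma psd_norm_sub b x y : psd_form b ->
  Num.sqrt (b (x - y) (x - y)) = Num.sqrt (b (y - x) (y - x)).
Proof.
case=> bD bZ bC b0; rewrite -(opprB y x) -(scaleN1r (y - x)) bZ bC bZ.
by rewrite !mulN1r opprK.
Qed.

(* Each step of the induction removes one vector from the form and records
   it as a functional with a random sign. *)
Lemma random_sign_functional (hs : seq H) b : psd_form b ->
  exists (W : finType) (l : W -> H -> R),
    [/\ (0 < #|W|)%N,
        forall o a x y, l o (a *: x + y) = a * l o x + l o y,
        forall h, \sum_o l o h ^+ 2 <= #|W|%:R * b h h,
        forall h, h \in hs -> \sum_o l o h ^+ 2 = #|W|%:R * b h h &
        forall h, #|W|%:R * (\sum_o l o h ^+ 4) <=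
          3 * (\sum_o l o h ^+ 2) ^+ 2].
Proof.
elim: hs b => [|g hs IH] b bP.
  (* What remains of the form once all of [hs] has been removed is dropped: hence equality on [hs]
     and an inequality elsewhere. *)
  exists unit, (fun _ _ => 0); rewrite card_unit; split=> //.
  - by move=> *; rewrite mulr0 addr0.
  - move=> h; rewrite big1 ?mul1r; last by move=> *; rewrite expr0n.
    by case: bP.
  - by move=> h; rewrite !big1 ?mulr0 ?expr0n// => *; rewrite expr0n.
have [bD bZ bC b0] := bP.
have [g0|g0] := eqVneq (b g g) 0.
  have [W [l [W0 lB lb le l4]]] := IH _ bP.
  exists W, l; split=> // h; rewrite inE => /predU1P[->|/le//].
  apply/eqP; rewrite eq_le lb g0 mulr0 /=.
  by apply: sumr_ge0 => o _; rewrite sqr_ge0.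
have gp : 0 < b g g by rewrite lt_neqAle eq_sym g0 b0.
(* The form of the components orthogonal to [g], as in a Gram-Schmidt step; [k] below is the
   component along [g]. *)
pose b' x y := b x y - b x g * b y g / b g g.
have b'P : psd_form b'.
  split.
  - by move=> x y z; rewrite /b' !bD; ring.
  - by move=> a x z; rewrite /b' !bZ; ring.
  - by move=> x y; rewrite /b' bC; ring.
  - move=> x; rewrite /b' subr_ge0 ler_pdivrMr//.
    by rewrite -expr2; apply: psd_cauchy_schwarz.
have [W [l [W0 lB lb le l4]]] := IH _ b'P.
pose k h := b h g / Num.sqrt (b g g).
have k2 h : k h ^+ 2 = b h g * b h g / b g g.
  by rewrite /k exprMn exprVn sqr_sqrtr ?ltW// expr2.
have kB a x y : k (a *: x + y) = a * k x + k y by rewrite /k bD bZ; ring.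
have b'E h : b' h h + k h ^+ 2 = b h h by rewrite k2 /b' subrK.
have b'g : b' g g = 0 by rewrite /b'; field.
clearbody k b'.
pose l' (o : W * bool) h := l o.1 h + (-1) ^+ o.2 * k h.
have S2 h : \sum_o l' o h ^+ 2 = 2 * (\sum_o l o h ^+ 2 + #|W|%:R * k h ^+ 2).
  rewrite -(pair_bigA _ (fun o e => l' (o, e) h ^+ 2)) /=.
  transitivity (\sum_o (2 * l o h ^+ 2 + 2 * k h ^+ 2)).
    apply: eq_bigr => o _; rewrite big_bool /l' /= expr1 expr0; ring.
  by rewrite big_split /= -mulr_sumr sumr_const -[_ *+ #|_|]mulr_natr; ring.
have S4 h : \sum_o l' o h ^+ 4 =
    2 * (\sum_o l o h ^+ 4 + 6 * k h ^+ 2 * (\sum_o l o h ^+ 2) +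
         #|W|%:R * k h ^+ 4).
  rewrite -(pair_bigA _ (fun o e => l' (o, e) h ^+ 4)) /=.
  transitivity (\sum_o (2 * l o h ^+ 4 + 12 * k h ^+ 2 * l o h ^+ 2 +
      2 * k h ^+ 4)).
    apply: eq_bigr => o _; rewrite big_bool /l' /= expr1 expr0; ring.
  rewrite !big_split /= -!mulr_sumr sumr_const -[_ *+ #|_|]mulr_natr; ring.
have cE : #|{: W * bool}|%:R = 2 * #|W|%:R :> R.
  by rewrite card_prod card_bool natrM mulrC.
exists (W * bool)%type, l'; split.
- by rewrite card_prod card_bool muln_gt0 W0.
- by move=> o a x y; rewrite /l' lB kB; ring.
- move=> h; rewrite S2 cE -b'E; have := lb h; nra.
- move=> h; rewrite inE => /predU1P[->|/le hh]; last first.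
    by rewrite S2 cE -b'E hh -mulrA -mulrDr.
  rewrite S2 cE -b'E.
  have -> : \sum_o l o g ^+ 2 = 0.
    apply/eqP; rewrite eq_le; have := lb g; rewrite b'g mulr0 => -> /=.
    by apply: sumr_ge0 => o _; rewrite sqr_ge0.
  by rewrite b'g; ring.
- move=> h; rewrite S2 S4 cE; have := l4 h.
  have n0 : 0 <= #|W|%:R :> R by [].
  set n := #|W|%:R in n0 *; set S := \sum_o _ ^+ 2; set Q := \sum_o _ ^+ 4.
  move=> h4; rewrite -subr_ge0.
  (* The mixed terms cancel exactly; they are what forces the constant 3, the one of a Gaussian
     variable. *)
  have -> : 3 * (2 * (S + n * k h ^+ 2)) ^+ 2 -
    2 * n * (2 * (Q + 6 * k h ^+ 2 * S + n * k h ^+ 4)) =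
    4 * (3 * S ^+ 2 - n * Q) + 8 * (n * k h ^+ 2) ^+ 2 by ring.
  have := sqr_ge0 (n * k h ^+ 2); lra.
Qed.

End SignFunctionals.

Section SmallBall.
Context (R : realType).

Lemma sum_ffun_prod (W : finType) d (F : W -> R) :
  \sum_(w : {ffun 'I_d -> W}) \prod_k F (w k) = (\sum_o F o) ^+ d.
Proof.
rewrite -(bigA_distr_bigA (fun (_ : 'I_d) o => F o)) /=.
by rewrite prodr_const card_ord.
Qed.

Lemma expRN_le (y : R) : 0 <= y -> expR (- y) <= 1 - y + y ^+ 2.
Proof.
move=> y0; rewrite expRN.
have y1 : 0 < 1 + y by rewrite ltr_wpDr.
apply: (@le_trans _ _ (1 + y)^-1).
  by rewrite lef_pV2 ?posrE ?expR_gt0// expR_ge1Dx.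
rewrite -div1r ler_pdivrMr//.
have -> : (1 - y + y ^+ 2) * (1 + y) = 1 + y ^+ 3 by ring.
by rewrite lerDl exprn_ge0.
Qed.

(** A Chernoff bound for the lower tail. The product over k of exp (1/72 - g^2 / 6) is at least 1 on
    the event counted, and by [expRN_le] and the two moments each factor has mean at most 72/71 (1 -
    1/6 + 3/36) = 66/71. *)
Lemma small_ball_count (W : finType) (g : W -> R) d : (0 < #|W|)%N ->
  \sum_o g o ^+ 2 = #|W|%:R ->
  #|W|%:R * \sum_o g o ^+ 4 <= 3 * (\sum_o g o ^+ 2) ^+ 2 ->
  \sum_(w : {ffun 'I_d -> W} | \sum_k g (w k) ^+ 2 < d%:R / 12) 1 <=
    (66 / 71) ^+ d * #|{ffun 'I_d -> W}|%:R :> R.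
Proof.
move=> W0 g2 g4.
have n0 : 0 < #|W|%:R :> R by rewrite ltr0n.
pose e o : R := expR (72^-1 - g o ^+ 2 / 6).
have e_le : \sum_o e o <= 66 / 71 * #|W|%:R.
  apply: (@le_trans _ _ (\sum_o (72 / 71 * (1 - g o ^+ 2 / 6 + (g o ^+ 2 / 6) ^+ 2)))).
    apply: ler_sum => o _; rewrite /e expRD; apply: ler_pM; rewrite ?expR_ge0//.
      rewrite -[X in expR X]opprK expRN.
      rewrite -(@ler_pM2l _ (71 / 72)) ?divr_gt0//.
      apply: (@le_trans _ _ (expR (- 72^-1) / expR (- 72^-1))); last first.
        by rewrite divff ?gt_eqF ?expR_gt0//; lra.
      rewrite ler_wpM2r ?invr_ge0 ?expR_ge0//.
      by apply: le_trans (expR_ge1Dx _); lra.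
    by apply: expRN_le; rewrite divr_ge0 ?sqr_ge0//.
  rewrite -mulr_sumr.
  have -> : \sum_o (1 - g o ^+ 2 / 6 + (g o ^+ 2 / 6) ^+ 2) =
      #|W|%:R - (\sum_o g o ^+ 2) / 6 + (\sum_o g o ^+ 4) / 36.
    rewrite !mulr_suml big_split /= big_split /= sumr_const sumrN.
    by congr (_ + _); apply: eq_bigr => o _; field.
  rewrite g2 in g4 *.
  have : \sum_o g o ^+ 4 <= 3 * #|W|%:R.
    by rewrite -(ler_pM2l n0); move: g4; rewrite expr2 mulrCA.
  by move: (\sum_o g o ^+ 4) => Q; lra.
rewrite card_ffun natrX card_ord -exprMn.
apply: (@le_trans _ _ ((\sum_o e o) ^+ d)); last first.
  by rewrite lerXn2r ?nnegrE ?mulr_ge0 ?sumr_ge0// => o _; exact: expR_ge0.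
rewrite -sum_ffun_prod big_mkcond /=.
apply: ler_sum => w _; case: ifPn => [|_]; last first.
  by apply: prodr_ge0 => k _; exact: expR_ge0.
move=> wd.
rewrite -expR_sum -[X in X <= _]expR0 ler_expR big_split /= sumr_const.
rewrite card_ord -mulr_natl sumrN -mulr_suml.
lra.
Qed.

End SmallBall.

(** * Partitions of unity subordinate to a cubic lattice *)

Section LatticePartition.
Context (R : realType).

Lemma card_near_integers n (c : R) :
  (#|[pred a : 'I_n | (`|c - a%:R| < 2)%R]| <= 4)%N.
Proof.
have [c0|c0] := ltP c (-2).
  rewrite eq_card0// => a; rewrite !inE; apply/negbTE; rewrite -leNgt.
  have a0 : 0 <= (a : nat)%:R :> R by [].
  by rewrite ler0_norm; lra.
pose f := Num.truncn (c + 2).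
have c2 : 0 <= c + 2 by lra.
have /andP[fl fu] := truncn_itv c2.
have aP (a : 'I_n) : `|c - a%:R| < 2 -> (f <= a + 3 <= f + 3)%N.
  rewrite ltr_norml => /andP[h1 h2].
  rewrite -/f -natr1 in fl fu; apply/andP; split.
    by rewrite -ltnS -(ltr_nat R) -natr1 natrD; lra.
  by rewrite leq_add2r -ltnS -(ltr_nat R) -natr1; lra.
apply: leq_trans (_ : #|'I_4| <= 4)%N; last by rewrite card_ord.
apply: (@leq_card_in _ _ (fun a : 'I_n => inord (a + 3 - f) : 'I_4)).
move=> a b; rewrite !inE => /aP/andP[a1 a2] /aP/andP[b1 b2] /(congr1 val).
rewrite /= !inordK; [|lia|lia].
by move=> ab; apply: val_inj => /=; lia.
Qed.

(** Tents of half-width 2 around the integers, divided by their l_2 norm. The tent at the integer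
    part of u is at least 1 there, so this norm is at least 1. At most 4 tents are active at each of
    u and w, and each varies by at most |u - w|: hence the 8. Clipping to [0, M] makes the finite
    lattice serve all reals. *)
Lemma lattice_weights M : exists v : 'I_M.+1 -> R -> R,
  [/\ forall a u, 0 <= v a u,
      forall u, \sum_a v a u ^+ 2 = 1,
      forall u w, \sum_a (v a u - v a w) ^+ 2 <= 8 * (u - w) ^+ 2 &
      forall a u, 0 <= u <= M%:R -> v a u != 0 -> `|u - a%:R| < 2].
Proof.
pose clip (u : R) := Num.min (Num.max u 0) M%:R.
have M0 : 0 <= M%:R :> R by [].
have clip_itv u : 0 <= clip u <= M%:R.
  by rewrite /clip; case: (leP u 0) => ?; [rewrite min_l//|case: (leP u) => ?];
    apply/andP; split; lra.
have clipE u : 0 <= u <= M%:R -> clip u = u.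
  by rewrite /clip => /andP[? ?]; rewrite max_l// min_l.
have clip_lip u w : `|clip u - clip w| <= `|u - w|.
  wlog uw : u w / w <= u.
    by move=> hw; have [/hw//|/ltW/hw] := leP w u; rewrite distrC [leRHS]distrC.
  rewrite [leRHS]ger0_norm ?subr_ge0// ler_norml /clip.
  by case: (leP u 0) => ?; case: (leP w 0) => ?; rewrite ?(min_l M0);
    rewrite ?(min_l M0); try (case: (leP u) => ?); try (case: (leP w) => ?);
    apply/andP; split; lra.
pose t (a : 'I_M.+1) u := Num.max (2 - `|clip u - a%:R|) 0.
have t0 a u : 0 <= t a u by rewrite le_max lexx orbT.
have t_lip a u w : `|t a u - t a w| <= `|u - w|.
  apply: le_trans (clip_lip _ _); rewrite /t.
  have h1 := lerB_dist (clip u - a%:R) (clip w - a%:R).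
  have h2 := lerB_dist (clip w - a%:R) (clip u - a%:R).
  have e1 : clip u - a%:R - (clip w - a%:R) = clip u - clip w by ring.
  have e2 : clip w - a%:R - (clip u - a%:R) = - (clip u - clip w) by ring.
  move: h1 h2; rewrite e1 e2 normrN.
  move: (`|clip u - a%:R|) (`|clip w - a%:R|) => x y h1 h2.
  by rewrite ler_norml; case: (leP (2 - x)) => ?; case: (leP (2 - y)) => ?;
    apply/andP; split; lra.
pose S u := \sum_a t a u ^+ 2.
have S1 u : 1 <= S u.
  have /andP[c0 cM] := clip_itv u.
  have /andP[fl fu] := truncn_itv c0.
  set f := Num.truncn _ in fl fu.
  have fM : (f < M.+1)%N.
    by rewrite ltnS -(ler_nat R); apply: le_trans cM.
  rewrite /S (bigD1 (Ordinal fM)) //=.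
  apply: ler_wpDr; first by apply: sumr_ge0 => a _; exact: sqr_ge0.
  apply: exprn_ege1; rewrite /t /= le_max; apply/orP; left.
  by rewrite -natr1 in fu; rewrite ger0_norm; lra.
have Sp u : 0 < S u by exact: lt_le_trans ltr01 (S1 u).
have Sg u : 0 < Num.sqrt (S u) by rewrite sqrtr_gt0.
have Sg1 u : 1 <= Num.sqrt (S u) by rewrite -sqrtr1 ler_wsqrtr.
have SE u : Num.sqrt (S u) ^+ 2 = S u by rewrite sqr_sqrtr// ltW.
exists (fun a u => t a u / Num.sqrt (S u)); split.
- by move=> a u; rewrite divr_ge0// ltW.
- move=> u; under eq_bigr do rewrite exprMn exprVn SE.
  by rewrite -mulr_suml -/(S u) divff// gt_eqF.
- move=> u w.
  (* Radial projection to the unit sphere does not increase the distance of vectors of norm at least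
     1. *)
  apply: (@le_trans _ _ (\sum_a (t a u - t a w) ^+ 2)).
    set s := \sum_a (t a u * t a w).
    have -> : \sum_a (t a u - t a w) ^+ 2 = S u + S w - 2 * s.
      rewrite /S /s mulr_sumr -sumrN -!big_split /=.
      by apply: eq_bigr => a _; ring.
    have expand X Y : 0 < X -> 0 < Y ->
        \sum_a (t a u / X - t a w / Y) ^+ 2 =
        S u / X ^+ 2 + S w / Y ^+ 2 - 2 / (X * Y) * s.
      move=> X0 Y0; rewrite /S /s mulr_sumr !mulr_suml -sumrN -!big_split /=.
      by apply: eq_bigr => a _; field; rewrite !gt_eqF.
    rewrite expand//.
    rewrite !SE !divff ?gt_eqF//.
    have [X1 Y1] := (Sg1 u, Sg1 w).
    have : 0 <= \sum_a (t a u / Num.sqrt (S u) - t a w / Num.sqrt (S w)) ^+ 2.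
      by apply: sumr_ge0 => a _; exact: sqr_ge0.
    rewrite expand//.
    rewrite !SE !divff ?gt_eqF//.
    have [XE YE] := (SE u, SE w).
    move: (Num.sqrt (S u)) (Num.sqrt (S w)) X1 Y1 XE YE => X Y X1 Y1 XE YE.
    set Q := 1 + 1 - _ => Q0.
    have XY0 : 0 < X * Y by rewrite mulr_gt0//; lra.
    have sE : 2 * s = X * Y * (2 - Q).
      by rewrite /Q; field; rewrite !gt_eqF//; lra.
    have := sqr_ge0 (X - Y); have : 1 <= X * Y by rewrite mulr_ege1.
    rewrite -subr_ge0 => /mulr_ge0/(_ Q0) XYQ XY2.
    by rewrite sE -XE -YE; move: XYQ XY2; clearbody Q; lra.
  have -> : 8 * (u - w) ^+ 2 = `|u - w| ^+ 2 * 8%:R.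
    by rewrite real_normK ?num_real// mulrC.
  apply: (@le_trans _ _ (\sum_(a : 'I_M.+1 | (`|clip u - a%:R| < 2) ||
      (`|clip w - a%:R| < 2)) `|u - w| ^+ 2)).
    rewrite [leRHS]big_mkcond /=; apply: ler_sum => a _.
    case: ifPn => [_|]; first by rewrite -real_normK ?num_real// lerXn2r ?nnegrE.
    rewrite negb_or -!leNgt => /andP[h1 h2].
    by rewrite /t !max_r; [rewrite subrr expr0n|lra|lra].
  rewrite sumr_const -[leLHS]mulr_natr ler_wpM2l ?sqr_ge0// ler_nat.
  have := cardUI [pred a : 'I_M.+1 | (`|clip u - a%:R| < 2)%R]
                 [pred a : 'I_M.+1 | (`|clip w - a%:R| < 2)%R].
  have := card_near_integers M.+1 (clip u).
  have := card_near_integers M.+1 (clip w).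
  set U := #|predU _ _| => h1 h2 h3.
  apply: (@leq_trans U); last by apply: leq_trans (leq_add h2 h1); rewrite -h3 leq_addr.
  by apply: subset_leq_card; apply/fintype.subsetP => a; rewrite !inE.
- move=> a u uM; rewrite mulf_eq0 negb_or /t clipE// => /andP[+ _].
  by case: (leP (2 - _)) => [_|]; rewrite ?eqxx//; lra.
Qed.

Lemma one_sub_prod_le d (g : 'I_d -> R) : (forall k, 0 <= g k <= 1) ->
  1 - \prod_k g k <= \sum_k (1 - g k).
Proof.
move=> g01.
suff [//] : 1 - \prod_k g k <= \sum_k (1 - g k) /\ 0 <= \prod_k g k <= 1.
apply: (big_rec2 (fun x y => 1 - x <= y /\ 0 <= x <= 1)).
  by split; rewrite ?subrr ?lexx ?ler01.
move=> k x y _ [xy /andP[x0 x1]]; have /andP[g0 g1] := g01 k.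
split; first by nra.
by rewrite mulr_ge0//= mulr_ile1.
Qed.

(* With q = V^2, where V is a tensor product of unit vectors, the l_1 distance
   between values of q is controlled by the l_2 distance between values of V,
   which depends on the dimension only through the Euclidean norm. *)
Lemma lattice_partition d M :
  exists q : {ffun 'I_d -> 'I_M.+1} -> ('I_d -> R) -> R,
  [/\ forall a u, 0 <= q a u,
      forall u, \sum_a q a u = 1,
      forall u w, \sum_a `|q a u - q a w| <=
        6 * Num.sqrt (\sum_k (u k - w k) ^+ 2) &
      forall a u w, (forall k, 0 <= u k <= M%:R) ->
        (forall k, 0 <= w k <= M%:R) -> q a u != 0 -> q a w != 0 ->
        forall k, `|u k - w k| <= 4].
Proof.
have [v [v0 v1 vl vs]] := lattice_weights M.
pose V (a : {ffun 'I_d -> 'I_M.+1}) (u : 'I_d -> R) := \prod_k v (a k) (u k).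
have V0 a u : 0 <= V a u by exact: prodr_ge0.
have VV u w : \sum_a V a u * V a w = \prod_k (\sum_i v i (u k) * v i (w k)).
  rewrite (bigA_distr_bigA (fun k i => v i (u k) * v i (w k))) /=.
  by apply: eq_bigr => a _; rewrite /V big_split.
have V1 u : \sum_a V a u ^+ 2 = 1.
  under eq_bigr do rewrite expr2.
  rewrite VV big1// => k _; rewrite -[RHS](v1 (u k)).
  by apply: eq_bigr => i _; rewrite expr2.
have vg (x y : R) : 2 * (1 - \sum_i v i x * v i y) = \sum_i (v i x - v i y) ^+ 2.
  have -> : \sum_i (v i x - v i y) ^+ 2 =
      \sum_i v i x ^+ 2 + \sum_i v i y ^+ 2 - 2 * \sum_i v i x * v i y.
    by rewrite mulr_sumr -sumrN -!big_split /=; apply: eq_bigr => i _; ring.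
  by rewrite !v1; ring.
(* Scalar products of tensor products multiply, and one minus a product of numbers in [0, 1] is at
   most the sum of the defects, so the squared distances of the coordinates simply add. *)
have VB u w : \sum_a (V a u - V a w) ^+ 2 <= 8 * \sum_k (u k - w k) ^+ 2.
  have -> : \sum_a (V a u - V a w) ^+ 2 = 2 * (1 - \sum_a V a u * V a w).
    have -> : \sum_a (V a u - V a w) ^+ 2 =
        \sum_a V a u ^+ 2 + \sum_a V a w ^+ 2 - 2 * \sum_a V a u * V a w.
      by rewrite mulr_sumr -sumrN -!big_split /=; apply: eq_bigr => i _; ring.
    by rewrite !V1; ring.
  rewrite VV mulr_sumr.
  apply: (@le_trans _ _ (2 * \sum_k (1 - \sum_i v i (u k) * v i (w k)))).
    rewrite ler_pM2l//; apply: one_sub_prod_le => k; apply/andP; split.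
      by apply: sumr_ge0 => i _; rewrite mulr_ge0.
    have : 0 <= \sum_i (v i (u k) - v i (w k)) ^+ 2.
      by apply: sumr_ge0 => i _; exact: sqr_ge0.
    by rewrite -vg; lra.
  by rewrite mulr_sumr; apply: ler_sum => k _; rewrite vg.
have VD u w : \sum_a (V a u + V a w) ^+ 2 <= 4.
  have -> : \sum_a (V a u + V a w) ^+ 2 =
      2 * (\sum_a V a u ^+ 2 + \sum_a V a w ^+ 2) - \sum_a (V a u - V a w) ^+ 2.
    rewrite -big_split /= mulr_sumr -sumrN -!big_split /=.
    by apply: eq_bigr => i _; ring.
  have : 0 <= \sum_a (V a u - V a w) ^+ 2.
    by apply: sumr_ge0 => i _; exact: sqr_ge0.
  by rewrite !V1; lra.
exists (fun a u => V a u ^+ 2); split.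
- by move=> a u; exact: sqr_ge0.
- by move=> u; exact: V1.
- move=> u w; set S := \sum_k (u k - w k) ^+ 2.
  have S0 : 0 <= S by apply: sumr_ge0 => k _; exact: sqr_ge0.
  set L := \sum_a _.
  (* Cauchy-Schwarz for |V - V'| |V + V'| in additive form; t = sqrt S gives 4 + 2 = 6. *)
  have amgm t : 0 < t -> L <= 4 * S / t + 2 * t.
    move=> t0.
    apply: (@le_trans _ _ (\sum_a ((V a u - V a w) ^+ 2 / (2 * t) +
        t / 2 * (V a u + V a w) ^+ 2))).
      apply: ler_sum => a _; rewrite subr_sqr normrM [X in _ * X]ger0_norm ?addr_ge0//.
      rewrite -[X in _ <= X / _ + _]real_normK ?num_real//.
      move: `|_| (V a u + V a w) => x y.
      rewrite -subr_ge0.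
      have -> : x ^+ 2 / (2 * t) + t / 2 * y ^+ 2 - x * y =
        (x - t * y) ^+ 2 / (2 * t) by field; rewrite gt_eqF.
      by rewrite divr_ge0 ?sqr_ge0// mulr_ge0// ltW.
    rewrite big_split /= -mulr_suml -mulr_sumr.
    apply: lerD; last by have := VD u w; nra.
    have -> : 4 * S / t = 8 * S / (2 * t) by field; rewrite gt_eqF.
    by rewrite ler_wpM2r ?VB// invr_ge0 mulr_ge0// ltW.
  have [S00|Sp] := eqVneq S 0.
    rewrite S00 sqrtr0 mulr0 leNgt; apply/negP => L0.
    have := amgm (L / 4); rewrite S00 mulr0 mul0r divr_gt0// => /(_ isT).
    by move: L0; clearbody L; lra.
  have sp : 0 < Num.sqrt S by rewrite sqrtr_gt0 lt_neqAle eq_sym Sp.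
  apply: le_trans (amgm _ sp) _.
  rewrite -[X in 4 * X]sqr_sqrtr// expr2 mulrA mulfK ?gt_eqF//.
  by rewrite -mulrDl; lra.
- move=> a u w uM wM; rewrite !sqrf_eq0 => /prodf_neq0 hu /prodf_neq0 hw k.
  have := vs _ _ (uM k) (hu k isT); have := vs _ _ (wM k) (hw k isT).
  move: (u k) (w k) => x y; move: (_%:R) => z.
  by rewrite !ltr_norml ler_norml => /andP[? ?] /andP[? ?]; apply/andP; split; lra.
Qed.

End LatticePartition.

(** * Random projections with a finite sample space *)

Section RandomProjection.
Context (R : realType).

(** The uniform measure on a power of [W] has uniform marginals; stated without division. *)
Lemma sum_ffun_coord (W : finType) d (k : 'I_d) (F : W -> R) :
  #|W|%:R * \sum_(w : {ffun 'I_d -> W}) F (w k) =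
  #|{ffun 'I_d -> W}|%:R * \sum_o F o.
Proof.
pose G (k' : 'I_d) o := if k' == k then F o else 1.
transitivity (#|W|%:R * \sum_(w : {ffun 'I_d -> W}) \prod_k' G k' (w k')).
  congr (_ * _); apply: eq_bigr => w _.
  rewrite (bigD1 k) //= /G eqxx big1 ?mulr1// => k' /negbTE ->//.
rewrite -(bigA_distr_bigA (fun k' o => G k' o)) /= (bigD1 k) //=.
have -> : \sum_j G k j = \sum_o F o.
  by apply: eq_bigr => o _; rewrite /G eqxx.
have -> : \prod_(i < d | i != k) \sum_j G i j = #|W|%:R ^+ d.-1.
  rewrite -[in RHS](card_ord d) -(cardC1 k) -prodr_const.
  apply: eq_big => [i|i /negbTE ik]; first by rewrite inE.
  by under eq_bigr do rewrite /G ik; rewrite sumr_const.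
rewrite card_ffun card_ord natrX mulrCA mulrC -exprS prednK//.
exact: leq_ltn_trans (ltn_ord k).
Qed.

Lemma ln2_ge : 2^-1 <= ln 2 :> R.
Proof.
rewrite -ler_expR lnK ?posrE// -[2^-1]opprK expRN invf_ple ?posrE ?expR_gt0//.
by apply: le_trans (expR_ge1Dx _); lra.
Qed.

(* JL dimension: the union bound over the N^2 differences needs
   N^2 (66/71)^d <= 1/4. *)
Lemma jl_dimension N : (2 <= N)%N -> exists d : nat,
  [/\ (0 < d)%N, Num.sqrt d%:R <= 8 * Num.sqrt (ln N%:R) :> R &
      (N ^ 2)%:R * (66 / 71) ^+ d <= 4^-1 :> R].
Proof.
move=> N2; have N2R : 2 <= N%:R :> R by rewrite ler_nat.
have ln2 := ln2_ge.
have lnN : 2^-1 <= ln N%:R :> R.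
  by apply: le_trans ln2 _; rewrite ler_ln ?posrE//; lra.
(* Since (66/71)^d <= exp (- 5 d / 71) and 57 * 5 / 71 > 4, the product is at most N^-2 <= 1/4.
   Rounding up costs 1 <= 2 ln N, and 59 <= 8^2. *)
pose d := (Num.truncn (57 * ln N%:R : R)).+1.
have x0 : 0 <= 57 * ln N%:R :> R by lra.
have /andP[dl du] := truncn_itv x0.
have dle : d%:R <= 59 * ln N%:R :> R by rewrite /d -natr1; lra.
have dge : 57 * ln N%:R <= d%:R :> R by exact: ltW.
have d0 : (0 < d)%N by [].
clearbody d; exists d; split=> //.
  rewrite -[8]ger0_norm// -sqrtr_sqr -sqrtrM ?sqr_ge0// ler_sqrt; lra.
have N0 : 0 < N%:R :> R by lra.
have -> : (N ^ 2)%:R = expR (2 * ln N%:R) :> R.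
  by rewrite mulrC expRM_natr lnK ?posrE// natrX.
have le1 : (66 / 71) ^+ d <= expR (- (5 / 71) * d%:R) :> R.
  rewrite expRM_natr lerXn2r ?nnegrE ?expR_ge0//.
  by apply: le_trans (expR_ge1Dx _); lra.
have le2 : expR (- (2 * ln 2)) <= 4^-1 :> R.
  have -> : 2 * ln 2 = ln 2 + ln 2 :> R by ring.
    by rewrite expRN expRD lnK ?posrE// lef_pV2 ?posrE//; lra.
apply: (@le_trans _ _ (expR (2 * ln N%:R) * expR (- (5 / 71) * d%:R))).
  by rewrite ler_wpM2l ?expR_ge0.
apply: le_trans le2; rewrite -expRD ler_expR.
have ln2N : ln 2 <= ln N%:R :> R by rewrite ler_ln ?posrE//; lra.
by rewrite -/d in du; lra.
Qed.

Context (H : lmodType R).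

(** A Johnson-Lindenstrauss projection made of d independent sign functionals. The lower bound on
    the differences of the z i is a union bound over pairs. The upper bound has to serve every h, so
    it comes from the second moment and holds on average only. *)
Lemma random_projection (b : H -> H -> R) N (z : 'I_N -> H) :
  psd_form b -> (2 <= N)%N ->
  exists (d : nat) (W : finType) (P : W -> 'I_d -> H -> R) (good : pred W),
  [/\ (0 < d)%N /\ Num.sqrt d%:R <= 8 * Num.sqrt (ln N%:R) :> R,
      (0 < #|W|)%N /\
        (forall w k a x y, P w k (a *: x + y) = a * P w k x + P w k y),
      forall h, \sum_w Num.sqrt (\sum_k P w k h ^+ 2) <=
        #|W|%:R * (Num.sqrt d%:R * Num.sqrt (b h h)),
      \sum_(w | ~~ good w) 1 <= #|W|%:R / 4 :> R &
      forall w, good w -> forall i j, d%:R / 12 * b (z i - z j) (z i - z j) <=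
        \sum_k P w k (z i - z j) ^+ 2].
Proof.
move=> bP N2; have [d [d0 dN dJL]] := jl_dimension N2.
have [bD bZ bC b0] := bP.
pose hs := [seq z ij.1 - z ij.2 | ij <- enum {: 'I_N * 'I_N}].
have [W [l [W0 lB lb le l4]]] := random_sign_functional hs bP.
have n0 : 0 < #|W|%:R :> R by rewrite ltr0n.
pose P (w : {ffun 'I_d -> W}) k h := l (w k) h.
pose bad (ij : 'I_N * 'I_N) (w : {ffun 'I_d -> W}) :=
  \sum_k P w k (z ij.1 - z ij.2) ^+ 2 <
    d%:R / 12 * b (z ij.1 - z ij.2) (z ij.1 - z ij.2).
have S0 w h : 0 <= \sum_k P w k h ^+ 2 by apply: sumr_ge0 => k _; exact: sqr_ge0.
have S2 h : \sum_w \sum_k P w k h ^+ 2 <= #|{ffun 'I_d -> W}|%:R * (d%:R * b h h).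
  rewrite exchange_big /= mulrCA -[d in d%:R * _]card_ord -sumr_const mulr_suml.
  apply: ler_sum => k _; rewrite mul1r -(ler_pM2l n0).
  by rewrite (sum_ffun_coord k (fun o => l o h ^+ 2)) mulrCA ler_wpM2l.
exists d, {ffun 'I_d -> W}, P, (fun w => ~~ [exists ij, bad ij w]); split=> //.
- by split; rewrite ?card_ffun ?expn_gt0 ?W0// => *; rewrite /P lB.
- move=> h; set t := Num.sqrt d%:R * Num.sqrt (b h h).
  have t0 : 0 <= t by rewrite mulr_ge0 ?sqrtr_ge0.
  have t2 : t ^+ 2 = d%:R * b h h by rewrite exprMn !sqr_sqrtr.
  have [tz|tn] := eqVneq t 0.
    rewrite tz mulr0 (_ : \sum_w _ = 0)//.
    apply: big1 => w _; apply/eqP; rewrite sqrtr_eq0.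
    have : \sum_w \sum_k P w k h ^+ 2 <= 0.
      by apply: le_trans (S2 h) _; rewrite -t2 tz expr0n mulr0.
    by apply: le_trans; rewrite (bigD1 w)//= lerDl sumr_ge0.
  have tp : 0 < t by rewrite lt_neqAle eq_sym tn.
  (* Jensen's inequality for the square root, as s <= s^2 / (2 t) + t / 2. *)
  apply: (@le_trans _ _ (\sum_w ((\sum_k P w k h ^+ 2) / (2 * t) + t / 2))).
    apply: ler_sum => w _; rewrite -[X in _ <= X / _ + _]sqr_sqrtr//.
    move: (Num.sqrt _) => s; rewrite -subr_ge0.
    have -> : s ^+ 2 / (2 * t) + t / 2 - s = (s - t) ^+ 2 / (2 * t) by field.
    by rewrite divr_ge0 ?sqr_ge0// mulr_ge0.
  rewrite big_split /= -mulr_suml sumr_const -[X in _ + X]mulr_natl.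
  have := S2 h; rewrite -t2.
  have t20 : 0 < (2 * t)^-1 by rewrite invr_gt0; lra.
  rewrite -(ler_pM2r t20) => S2'.
  apply: le_trans (lerD S2' (lexx _)) _.
  by rewrite le_eqVlt; apply/orP; left; apply/eqP; field.
- under eq_bigl do rewrite negbK.
  have count ij : \sum_(w | bad ij w) 1 <=
      (66 / 71) ^+ d * #|{ffun 'I_d -> W}|%:R :> R.
    rewrite /bad; set h := z ij.1 - z ij.2.
    have [h0|hn] := eqVneq (b h h) 0.
      rewrite big1 => [|w]; last by rewrite h0 mulr0 ltNge S0.
      by rewrite mulr_ge0// exprn_ge0.
    have hp : 0 < b h h by rewrite lt_neqAle eq_sym hn b0.
    have hin : h \in hs by apply/mapP; exists ij => //; rewrite mem_enum.
    pose g o := l o h / Num.sqrt (b h h).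
    have g2 o : g o ^+ 2 = l o h ^+ 2 / b h h by rewrite exprMn exprVn sqr_sqrtr.
    have sg2 : \sum_o g o ^+ 2 = #|W|%:R.
      by under eq_bigr do rewrite g2; rewrite -mulr_suml le// mulfK.
    have sg4 : #|W|%:R * \sum_o g o ^+ 4 <= 3 * (\sum_o g o ^+ 2) ^+ 2.
      have -> : \sum_o g o ^+ 4 = (\sum_o l o h ^+ 4) / b h h ^+ 2.
        rewrite mulr_suml; apply: eq_bigr => o _.
        by rewrite (exprM _ 2 2) g2; field.
      have -> : \sum_o g o ^+ 2 = (\sum_o l o h ^+ 2) / b h h.
        by under eq_bigr do rewrite g2; rewrite -mulr_suml.
      rewrite exprMn exprVn 2!(mulrA _ _ (b h h ^+ 2)^-1).
      by rewrite ler_wpM2r ?invr_ge0 ?sqr_ge0//; exact: l4.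
    apply: le_trans (small_ball_count d W0 sg2 sg4).
    rewrite le_eqVlt; apply/orP; left; apply/eqP; apply: eq_bigl => w.
    under [in RHS]eq_bigr do rewrite g2.
    by rewrite -mulr_suml ltr_pdivrMr.
  apply: (@le_trans _ _ (\sum_(ij : 'I_N * 'I_N) \sum_(w | bad ij w) 1)).
    rewrite big_mkcond /=; under [leRHS]eq_bigr do rewrite big_mkcond /=.
    rewrite exchange_big /=; apply: ler_sum => w _; case: ifPn => [|_].
      move=> /existsP[ij hij]; rewrite (bigD1 ij) //= hij lerDl.
      by apply: sumr_ge0 => ij' _; case: ifP.
    by apply: sumr_ge0 => ij' _; case: ifP.
  apply: le_trans (ler_sum _ (fun ij _ => count ij)) _.
  rewrite sumr_const card_prod card_ord -[leLHS]mulr_natl mulrA [leRHS]mulrC.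
  by rewrite ler_wpM2r// -expnS.
- move=> w /existsPn nb i j; have := nb (i, j).
  by rewrite /bad -leNgt.
Qed.

(** Write f / F - g / G = (f - g) / F + g (G - F) / (F G): after summation each of the two parts is
    at most D / F. *)
Lemma normalized_weights_le (J : Type) (r : seq J) (f g : J -> R) :
  (forall j, 0 <= f j) -> (forall j, 0 <= g j) ->
  0 < \sum_(j <- r) f j -> 0 < \sum_(j <- r) g j ->
  \sum_(j <- r) `|f j / (\sum_(j <- r) f j) - g j / (\sum_(j <- r) g j)| <=
  2 * (\sum_(j <- r) `|f j - g j|) / \sum_(j <- r) f j.
Proof.
move=> f0 g0 F0 G0; set F := \sum_(j <- r) f j in F0 *.
set G := \sum_(j <- r) g j in G0 *; set D := \sum_(j <- r) `|f j - g j|.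
have FG : `|G - F| <= D.
  rewrite distrC /F /G -sumrB; exact: ler_norm_sum.
apply: (@le_trans _ _ (\sum_(j <- r) (`|f j - g j| / F + g j * (D / (F * G))))).
  apply: ler_sum => j _.
  have -> : f j / F - g j / G = (f j - g j) / F + g j * ((G - F) / (F * G)).
    by field; rewrite !gt_eqF.
  apply: le_trans (ler_normD _ _) _; rewrite !(normrM, normfV).
  rewrite (ger0_norm (g0 j)) (gtr0_norm F0) (gtr0_norm G0) lerD2l.
  by rewrite !ler_wpM2l// ler_wpM2r// invr_ge0 mulr_ge0// ltW.
rewrite big_split /= -!mulr_suml -/D -/G le_eqVlt; apply/orP; left; apply/eqP.
by field; rewrite !gt_eqF.
Qed.

End RandomProjection.

(** * Partitions of unity in Hilbert space *)

Section HilbertPartition.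
Context (R : realType) (H : lmodType R) (b : H -> H -> R) (bP : psd_form b).
Local Notation nrm x := (Num.sqrt (b x x)).

(* The lattice partition is pulled back by a random projection, and kap is a
   cutoff: it discards the projections that are not short on x - z i, which may
   exist because only the average of a projection over the signs is bounded. *)
Lemma hilbert_partition N (z : 'I_N -> H) (del : R) : (2 <= N)%N -> 0 < del ->
  exists (J : finType) (w : H -> J -> R),
  [/\ forall x j, 0 <= w x j,
      forall x, (exists i, nrm (x - z i) <= del) -> \sum_j w x j = 1,
      forall x y, (exists i, nrm (x - z i) <= del) ->
        (exists i, nrm (y - z i) <= del) ->
        \sum_j `|w x j - w y j| <=
          256 * Num.sqrt (ln N%:R) / del * nrm (x - y) &
      forall x y j, w x j != 0 -> w y j != 0 -> nrm (x - y) <= 46 * del].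
Proof.
move=> N2 del0.
have [d [W [P [good [[d0 dN] [W0 Plin] Pavg bad_le goodP]]]]] :=
  random_projection z bP N2.
have n0 : 0 < #|W|%:R :> R by rewrite ltr0n.
have [bD bZ bC b0] := bP.
have PP w : psd_form (fun x y => \sum_k P w k x * P w k y).
  split.
  - move=> x y t; rewrite -big_split /=; apply: eq_bigr => k _.
    by rewrite -[x]scale1r Plin scale1r; ring.
  - move=> a x t; rewrite mulr_sumr; apply: eq_bigr => k _.
    have P0 : P w k 0 = 0.
      by have := Plin w k (-1) 0 0; rewrite scaler0 add0r; lra.
    by rewrite -[a *: x]addr0 Plin P0; ring.
  - by move=> x y; apply: eq_bigr => k _; rewrite mulrC.
  - by move=> x; apply: sumr_ge0 => k _; rewrite -expr2 sqr_ge0.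
pose pn w h := Num.sqrt (\sum_k P w k h ^+ 2).
have pnE w h : pn w h = Num.sqrt (\sum_k P w k h * P w k h).
  by congr Num.sqrt; apply: eq_bigr => k _; rewrite expr2.
have pn0 w h : 0 <= pn w h by exact: sqrtr_ge0.
have pn_tri w x y t : pn w (x - t) <= pn w (x - y) + pn w (y - t).
  rewrite !pnE; apply: le_trans (psd_triangle _ _ (PP w)).
  by rewrite addrA subrK.
have pn_sym w x y : pn w (x - y) = pn w (y - x).
  by rewrite !pnE (psd_norm_sub _ _ (PP w)).
have tri x y t : nrm (x - t) <= nrm (x - y) + nrm (y - t).
  by apply: le_trans (psd_triangle _ _ bP); rewrite addrA subrK.
have sym x y : nrm (x - y) = nrm (y - x) := psd_norm_sub x y bP.
have P_le w k h : `|P w k h| <= pn w h.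
  rewrite -sqrtr_sqr ler_wsqrtr// (bigD1 k)//= lerDl.
  by apply: sumr_ge0 => i _; exact: sqr_ge0.
have PB w k x y : P w k (x - y) = P w k x - P w k y.
  by rewrite addrC -scaleN1r Plin; ring.
pose sd : R := Num.sqrt d%:R.
have sd1 : 1 <= sd by rewrite -sqrtr1 ler_wsqrtr// ler1n.
have sd0 : 0 < sd by exact: lt_le_trans ltr01 sd1.
(* If x is within [del] of z i, then [pn w (x - z i)] has mean at most [bet] / 4. So the cutoff has
   mean at least 3/4, and at least 1/2 is left after the bad projections are discarded. *)
pose bet := 4 * sd * del.
have bet0 : 0 < bet by rewrite !mulr_gt0.
have [[del_ge0 sd_ge0] bet_ge0] := (ltW del0, ltW sd0, ltW bet0).
have di0 : 0 <= del^-1 by rewrite invr_ge0.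
have bi0 : 0 <= bet^-1 by rewrite invr_ge0.
pose Lam := \sum_w \sum_k \sum_i `|P w k (z i)|.
have Lam_ge w k i : `|P w k (z i)| <= Lam.
  rewrite /Lam (bigD1 w)//= (bigD1 k)//= (bigD1 i)//= -!addrA lerDl.
  by rewrite !addr_ge0// ?sumr_ge0// => *; rewrite ?sumr_ge0// => *; rewrite ?sumr_ge0.
have Lam0 : 0 <= Lam by do 3 (apply: sumr_ge0 => ? _).
(* Translation by B puts every coordinate P w k x / del with nonzero cutoff into [0, 2 B], the range
   of a finite lattice: [Lam] bounds the images of the z i and [bet] the deviation from them. *)
pose B := (Num.truncn ((Lam + bet) / del)).+1.
have BP : (Lam + bet) / del <= B%:R.
  have x0 : 0 <= (Lam + bet) / del by rewrite divr_ge0 ?addr_ge0//.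
  by have /andP[_ /ltW] := truncn_itv x0.
have [q [q0 q1 qlip qsupp]] := lattice_partition R d (B + B).
pose u w x (k : 'I_d) := P w k x / del + B%:R.
(* The first term confines x to distance 2 [del] from z i, and is at least 1 within [del]; the
   second one asks that the projection be short on x - z i. *)
pose kk w x i := Num.min (2 - nrm (x - z i) / del) (1 - pn w (x - z i) / bet).
pose kap w x := \big[Num.max/0]_i kk w x i.
have kap0 w x : 0 <= kap w x by exact: bigmax_ge_id.
have kap1 w x : kap w x <= 1.
  apply: bigmax_le => // i _; rewrite ge_min; apply/orP; right.
  by rewrite gerBl divr_ge0//.
have kap_lip1 w x y : kap w x <= kap w y + (nrm (x - y) / del + pn w (x - y) / bet).
  have D1 : 0 <= nrm (x - y) / del by rewrite divr_ge0 ?sqrtr_ge0//.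
  have D2 : 0 <= pn w (x - y) / bet by rewrite divr_ge0//.
  apply: bigmax_le => [|i _]; first by rewrite !addr_ge0.
  apply: (@le_trans _ _ (kk w y i + (nrm (x - y) / del + pn w (x - y) / bet)));
    last first.
    by rewrite lerD2r; exact: le_bigmax.
  have h1 : nrm (y - z i) / del <= nrm (x - y) / del + nrm (x - z i) / del.
    by rewrite -mulrDl ler_wpM2r// (sym x y) tri.
  have h2 : pn w (y - z i) / bet <= pn w (x - y) / bet + pn w (x - z i) / bet.
    by rewrite -mulrDl ler_wpM2r// (pn_sym w x y) pn_tri.
  rewrite -lerBlDr le_min !lerBlDr; apply/andP; split.
    by rewrite ge_min; apply/orP; left; lra.
  by rewrite ge_min; apply/orP; right; lra.
have kap_lip w x y :
    `|kap w x - kap w y| <= nrm (x - y) / del + pn w (x - y) / bet.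
  rewrite ler_norml; have := kap_lip1 w x y; have := kap_lip1 w y x.
  by rewrite (sym y x) (pn_sym w y x) => ? ?; apply/andP; split; lra.
have kapP w x : kap w x != 0 ->
    exists i, nrm (x - z i) <= 2 * del /\ pn w (x - z i) <= bet.
  move=> kn; have kp : 0 < kap w x by rewrite lt_neqAle eq_sym kn kap0.
  have [i hi] : exists i, 0 < kk w x i.
    apply: contrapT => /forallNP hn; move: kp; rewrite ltNge => /negP; apply.
    by apply: bigmax_le => // i _; rewrite leNgt; apply/negP.
  exists i; move: hi; rewrite lt_min !subr_gt0 !ltr_pdivrMr// mul1r.
  by move=> /andP[/ltW ? /ltW ?].
have u_itv w x : kap w x != 0 -> forall k, 0 <= u w x k <= (B + B)%:R.
  move=> /kapP[i [_ hp]] k.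
  have hP : `|P w k x / del| <= B%:R.
    apply: le_trans BP; rewrite normrM normfV (gtr0_norm del0).
    rewrite ler_wpM2r//.
    rewrite -[X in P w k X](subrK (z i)) -[X in P w k (_ + X)]opprK PB.
    have -> : P w k (x - z i) - P w k (- z i) = P w k (x - z i) + P w k (z i).
      by have := PB w k 0 (z i); rewrite sub0r; have := PB w k 0 0; rewrite subr0; lra.
    apply: le_trans (ler_normD _ _) _; rewrite addrC lerD//.
    by apply: le_trans hp.
  by move: hP; rewrite ler_norml /u natrD => /andP[? ?]; apply/andP; split; lra.
pose Wt x (j : W * {ffun 'I_d -> 'I_(B + B).+1}) :=
  if good j.1 then kap j.1 x * q j.2 (u j.1 x) else 0.
have Wt0 x j : 0 <= Wt x j by rewrite /Wt; case: ifP => // _; rewrite mulr_ge0.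
have SE x : \sum_j Wt x j = \sum_(w | good w) kap w x.
  rewrite -(pair_bigA _ (fun w a => Wt x (w, a))) /= [RHS]big_mkcond /=.
  apply: eq_bigr => w _; rewrite /Wt /=; case: ifP => _; last exact: big1.
  by rewrite -mulr_sumr q1 mulr1.
have S_ge x : (exists i, nrm (x - z i) <= del) -> #|W|%:R / 2 <= \sum_j Wt x j.
  move=> [i xi]; rewrite SE.
  have kge w : 1 - pn w (x - z i) / bet <= kap w x.
    apply: le_trans (le_bigmax _ _ i); rewrite le_min lexx andbT.
    have : nrm (x - z i) / del <= 1 by rewrite ler_pdivrMr// mul1r.
    have : 0 <= pn w (x - z i) / bet by rewrite divr_ge0//.
    by lra.
  have : \sum_w (1 - pn w (x - z i) / bet) <= \sum_w kap w x by exact: ler_sum.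
  rewrite sumrB sumr_const -mulr_suml => h1.
  have h2 : \sum_w kap w x <= \sum_(w | good w) kap w x + #|W|%:R / 4.
    rewrite (bigID good) /= lerD2l; apply: le_trans bad_le.
    exact: ler_sum.
  have h3 : (\sum_w pn w (x - z i)) / bet <= #|W|%:R / 4.
    rewrite ler_pdivrMr//; apply: le_trans (Pavg _) _.
    rewrite /bet -/sd.
    have -> : #|W|%:R / 4 * (4 * sd * del) = #|W|%:R * (sd * del) by field.
    by rewrite !ler_wpM2l//.
  by move: h1 h2 h3; rewrite -[1 *+ _]/(#|W|%:R); lra.
have S_pos x : (exists i, nrm (x - z i) <= del) -> 0 < \sum_j Wt x j.
  by move=> /S_ge; apply: lt_le_trans; rewrite divr_gt0.
have diff x y : \sum_j `|Wt x j - Wt y j| <= #|W|%:R * (8 * sd / del * nrm (x - y)).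
  have one w : \sum_a `|Wt x (w, a) - Wt y (w, a)| <=
      nrm (x - y) / del + pn w (x - y) / bet + 6 * (pn w (x - y) / del).
    have D1 : 0 <= nrm (x - y) / del by rewrite divr_ge0 ?sqrtr_ge0//.
    have D2 : 0 <= pn w (x - y) / bet by rewrite divr_ge0//.
    have D3 : 0 <= pn w (x - y) / del by rewrite divr_ge0//.
    rewrite /Wt /=; case: (good w); last first.
      rewrite big1 => [|a _]; last by rewrite subrr normr0.
      by rewrite !addr_ge0// mulr_ge0.
    apply: (@le_trans _ _ (\sum_a (`|kap w x - kap w y| * q a (u w x) +
        `|q a (u w x) - q a (u w y)|))).
      apply: ler_sum => a _.
      have -> : kap w x * q a (u w x) - kap w y * q a (u w y) =
        (kap w x - kap w y) * q a (u w x) + kap w y * (q a (u w x) - q a (u w y)).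
        by ring.
      apply: le_trans (ler_normD _ _) _; rewrite !normrM (ger0_norm (q0 _ _)).
      by rewrite lerD2l (ger0_norm (kap0 _ _)) ler_piMl.
    rewrite big_split /= -mulr_sumr q1 mulr1; apply: lerD; first exact: kap_lip.
    apply: le_trans (qlip _ _) _; rewrite ler_pM2l//.
    have -> : \sum_k (u w x k - u w y k) ^+ 2 = (\sum_k P w k (x - y) ^+ 2) / del ^+ 2.
      rewrite mulr_suml; apply: eq_bigr => k _; rewrite /u PB.
      by field; rewrite gt_eqF.
    rewrite sqrtrM ?sumr_ge0// => [|k _]; last exact: sqr_ge0.
    by rewrite sqrtrV ?sqr_ge0// sqrtr_sqr gtr0_norm.
  rewrite -(pair_bigA _ (fun w a => `|Wt x (w, a) - Wt y (w, a)|)) /=.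
  apply: le_trans (ler_sum _ (fun w _ => one w)) _.
  rewrite !big_split /= sumr_const -mulr_sumr -!mulr_suml.
  have h := Pavg (x - y); rewrite -/sd in h.
  set Q := \sum_w pn w (x - y); have {}h : Q <= #|W|%:R * (sd * nrm (x - y)) by [].
  have h1 : Q / bet <= #|W|%:R * (nrm (x - y) / del) / 4.
    rewrite ler_pdivrMr//; apply: le_trans h _.
    rewrite /bet le_eqVlt; apply/orP; left; apply/eqP; field.
    by rewrite gt_eqF.
  have h2 : Q / del <= #|W|%:R * sd * (nrm (x - y) / del).
    rewrite ler_pdivrMr//; apply: le_trans h _.
    rewrite le_eqVlt; apply/orP; left; apply/eqP; field.
    by rewrite gt_eqF.
  rewrite -[_ *+ _]mulr_natl -[#|_|]/#|W|.
  have -> : #|W|%:R * (8 * sd / del * nrm (x - y)) =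
    8 * (#|W|%:R * sd * (nrm (x - y) / del)) by field; rewrite gt_eqF.
  have h3 : #|W|%:R * (nrm (x - y) / del) <= #|W|%:R * sd * (nrm (x - y) / del).
    rewrite -mulrA ler_wpM2l// ler_peMl// divr_ge0 ?sqrtr_ge0////.
  have h4 : 0 <= #|W|%:R * (nrm (x - y) / del).
    by rewrite mulr_ge0// divr_ge0 ?sqrtr_ge0.
  move: h1 h2 h3 h4.
  by move: (_ / bet) (Q / del) (_ * (nrm _ / del)) (_ * (nrm _ / del)) => *; lra.
exists (W * {ffun 'I_d -> 'I_(B + B).+1})%type, (fun x j => Wt x j / \sum_j Wt x j).
split.
- by move=> x j; rewrite divr_ge0// sumr_ge0.
- by move=> x /S_pos S0; rewrite -mulr_suml divff// gt_eqF.
- move=> x y hx hy.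
  (* 256 = 2 * 8 * 2 * 8: normalization, variation of [Wt], total weight at least half of [#|W|],
     and sd <= 8 sqrt (ln N). *)
  apply: le_trans (normalized_weights_le (Wt0 x) (Wt0 y) (S_pos _ hx) (S_pos _ hy)) _.
  rewrite ler_pdivrMr ?S_pos//.
  apply: (@le_trans _ _ (2 * (#|W|%:R * (8 * sd / del * nrm (x - y))))).
    by rewrite ler_pM2l.
  have T0 : 0 <= nrm (x - y) / del by rewrite divr_ge0 ?sqrtr_ge0//.
  have C0 : 0 <= 256 * Num.sqrt (ln N%:R) / del * nrm (x - y).
    have LN := sqrtr_ge0 (ln N%:R : R).
    have : 0 <= Num.sqrt (ln N%:R) * (nrm (x - y) / del) by rewrite mulr_ge0.
    by rewrite -[256 * _ / del]mulrA -mulrA -mulrA [del^-1 * _]mulrC; lra.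
  apply: le_trans (ler_wpM2l C0 (S_ge _ hx)).
  have -> : 2 * (#|W|%:R * (8 * sd / del * nrm (x - y))) =
    sd * (16 * #|W|%:R * (nrm (x - y) / del)) by field; rewrite gt_eqF.
  have -> : 256 * Num.sqrt (ln N%:R) / del * nrm (x - y) * (#|W|%:R / 2) =
    (8 * Num.sqrt (ln N%:R)) * (16 * #|W|%:R * (nrm (x - y) / del)).
    by field; rewrite gt_eqF.
  by rewrite ler_wpM2r// !mulr_ge0.
- move=> x y [w a]; rewrite !mulf_eq0 !negb_or /Wt /=.
  case: ifP => gw; last by rewrite eqxx.
  rewrite !mulf_eq0 !negb_or => /andP[/andP[kx qx] _] /andP[/andP[ky qy] _].
  have [i [xi pxi]] := kapP _ _ kx; have [j [yj pyj]] := kapP _ _ ky.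
  have uu := qsupp a _ _ (u_itv _ _ kx) (u_itv _ _ ky) qx qy.
  have pxy : pn w (x - y) <= 4 * del * sd.
    rewrite -[4 * del]ger0_norm ?mulr_ge0// -sqrtr_sqr -sqrtrM ?sqr_ge0//.
    rewrite ler_wsqrtr// mulr_natr -[d in _ *+ d]card_ord -sumr_const.
    apply: ler_sum => k _; rewrite -[leLHS]real_normK ?num_real//.
    rewrite lerXn2r ?nnegrE?mulr_ge0//.
    have := uu k; rewrite /u.
    have -> : P w k x / del + B%:R - (P w k y / del + B%:R) = P w k (x - y) / del.
      by rewrite PB; field; rewrite gt_eqF.
    by rewrite normrM normfV (gtr0_norm del0) ler_pdivrMr.
  have pij : pn w (z i - z j) <= 12 * sd * del.
    have t1 := pn_tri w (z i) x (z j); have t2 := pn_tri w x y (z j).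
    by move: t1; rewrite (pn_sym w (z i) x) => t1; rewrite /bet in pxi pyj; lra.
  (* A good projection shortens z i - z j by at most the factor 12^(-1/2), and 12 * sqrt 12 < 42.
     The passage to x and y adds 2 + 2. *)
  have nij : nrm (z i - z j) <= 42 * del.
    have := goodP w gw i j.
    have -> : \sum_k P w k (z i - z j) ^+ 2 = pn w (z i - z j) ^+ 2.
      by rewrite sqr_sqrtr// sumr_ge0// => k _; exact: sqr_ge0.
    move=> gle.
    have {}gle : d%:R / 12 * b (z i - z j) (z i - z j) <= (12 * sd * del) ^+ 2.
      apply: le_trans gle _; rewrite lerXn2r ?nnegrE ?mulr_ge0//.
    have d0R : 0 < d%:R :> R by rewrite ltr0n.
    have sd2 : sd ^+ 2 = d%:R by rewrite sqr_sqrtr.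
    rewrite -[42 * del]ger0_norm ?mulr_ge0// -sqrtr_sqr ler_wsqrtr//.
    move: gle; rewrite !exprMn sd2.
    have -> : d%:R / 12 * b (z i - z j) (z i - z j) =
      d%:R * (b (z i - z j) (z i - z j) / 12) by ring.
    have -> : 12 ^+ 2 * d%:R * del ^+ 2 = d%:R * (12 ^+ 2 * del ^+ 2) by ring.
    by rewrite ler_pM2l//; have := sqr_ge0 del; lra.
  have t1 := tri x (z i) y; have t2 := tri (z i) (z j) y.
  by move: t2; rewrite (sym (z j) y); lra.
Qed.

End HilbertPartition.

(** * Gluing *)

Section Gluing.
Context (R : realType) (Z : normedModType R).

Lemma convex_combination_dist (J : Type) (r : seq J) (w : J -> R) (h : J -> Z)
    (g : Z) (B : R) :
  (forall j, 0 <= w j) -> \sum_(j <- r) w j = 1 ->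
  (forall j, w j != 0 -> `|h j - g| <= B) ->
  `|\sum_(j <- r) w j *: h j - g| <= B.
Proof.
move=> w0 w1 hB.
have -> : \sum_(j <- r) w j *: h j - g = \sum_(j <- r) w j *: (h j - g).
  rewrite -[X in _ - X]scale1r -w1 scaler_suml -sumrB.
  by apply: eq_bigr => j _; rewrite scalerBr.
apply: le_trans (ler_norm_sum _ _ _) _.
rewrite -[leRHS]mul1r -w1 mulr_suml; apply: ler_sum => j _.
rewrite normrZ (ger0_norm (w0 j)).
have [->|/hB] := eqVneq (w j) 0; first by rewrite !mul0r.
exact: ler_wpM2l.
Qed.

(** At each j the smaller weight carries [h1 j - h2 j], while the excess of the larger one carries a
    distance to g. All bounds are asked only where the weights are nonzero, as a local function is
    controlled on its own cell only. *)
Lemma convex_combinations_dist (J : Type) (r : seq J) (w1 w2 : J -> R)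
    (h1 h2 : J -> Z) (g : Z) (B L : R) :
  (forall j, 0 <= w1 j) -> (forall j, 0 <= w2 j) ->
  \sum_(j <- r) w1 j = 1 -> \sum_(j <- r) w2 j = 1 ->
  0 <= L ->
  (forall j, w1 j != 0 -> `|h1 j - g| <= B) ->
  (forall j, w2 j != 0 -> `|h2 j - g| <= B) ->
  (forall j, w1 j != 0 -> w2 j != 0 -> `|h1 j - h2 j| <= L) ->
  `|\sum_(j <- r) w1 j *: h1 j - \sum_(j <- r) w2 j *: h2 j| <=
    L + B * \sum_(j <- r) `|w1 j - w2 j|.
Proof.
move=> w10 w20 w11 w21 L0 hB1 hB2 hL.
have -> : \sum_(j <- r) w1 j *: h1 j - \sum_(j <- r) w2 j *: h2 j =
    \sum_(j <- r) (w1 j *: (h1 j - g) - w2 j *: (h2 j - g)).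
  transitivity (\sum_(j <- r) w1 j *: h1 j - (\sum_(j <- r) w1 j) *: g -
      (\sum_(j <- r) w2 j *: h2 j - (\sum_(j <- r) w2 j) *: g)).
    by rewrite w11 w21 opprB addrA subrK.
  rewrite !scaler_suml -!sumrB; apply: eq_bigr => j _.
  by rewrite !scalerBr.
apply: le_trans (ler_norm_sum _ _ _) _.
rewrite mulr_sumr -[L in L + _]mulr1 -w11 mulr_sumr -big_split /=.
apply: ler_sum => j _.
have [-> |n1] := eqVneq (w1 j) 0.
  rewrite scale0r sub0r normrN normrZ mulr0 add0r sub0r normrN mulrC.
  have [->|/hB2] := eqVneq (w2 j) 0; first by rewrite normr0 !mulr0.
  exact: ler_wpM2r.
have [-> |n2] := eqVneq (w2 j) 0.
  rewrite scale0r !subr0 normrZ (ger0_norm (w10 j)).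
  rewrite ler_wpDl ?mulr_ge0// mulrC; apply: ler_wpM2r => //; exact: hB1.
have B0 : 0 <= B by apply: le_trans (hB1 j n1).
have hE : h1 j - h2 j = (h1 j - g) - (h2 j - g) by rewrite opprB addrA subrK.
have [w12|w21'] := leP (w1 j) (w2 j).
  have -> : w1 j *: (h1 j - g) - w2 j *: (h2 j - g) =
      w1 j *: (h1 j - h2 j) - (w2 j - w1 j) *: (h2 j - g).
    rewrite hE; move: (h1 j - g) (h2 j - g) => x y.
    by rewrite scalerBr scalerBl opprB addrA subrK.
  apply: le_trans (ler_normB _ _) _; rewrite !normrZ (ger0_norm (w10 j)).
  apply: lerD; first by rewrite mulrC ler_wpM2r// hL.
  by rewrite mulrC [`|w1 j - _|]distrC ler_wpM2r// hB2.
have -> : w1 j *: (h1 j - g) - w2 j *: (h2 j - g) =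
    w2 j *: (h1 j - h2 j) + (w1 j - w2 j) *: (h1 j - g).
  rewrite hE; move: (h1 j - g) (h2 j - g) => x y.
  by rewrite scalerBr scalerBl [RHS]addrC addrA subrK.
apply: le_trans (ler_normD _ _) _; rewrite !normrZ (ger0_norm (w20 j)).
apply: lerD; last by rewrite mulrC ler_wpM2r// hB1.
rewrite mulrC; apply: le_trans (_ : L * w2 j <= _).
  by rewrite ler_wpM2r// hL.
by rewrite ler_wpM2l// ltW.
Qed.

End Gluing.

(** * Doubling subsets of a seminormed space *)

Section Seminorm.
Context (R : realType) (V : lmodType R).
Implicit Types (nu : V -> R) (D : set V) (x y c : V).

Definition seminorm nu :=
  (forall x y, nu (x + y) <= nu x + nu y) /\
  (forall a x, nu (a *: x) = `|a| * nu x).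

Lemma seminorm_sym nu x y : seminorm nu -> nu (x - y) = nu (y - x).
Proof.
by case=> _ nZ; rewrite -(opprB y x) -(scaleN1r (y - x)) nZ normrN1 mul1r.
Qed.

Lemma seminorm_dist_triangle nu y x z : seminorm nu ->
  nu (x - z) <= nu (x - y) + nu (y - z).
Proof. by case=> nD _; apply: le_trans (nD _ _); rewrite addrA subrK. Qed.

Lemma seminorm0 nu : seminorm nu -> nu 0 = 0.
Proof. by case=> _ nZ; rewrite -(scale0r 0) nZ normr0 mul0r. Qed.

Lemma seminorm_ge0 nu x : seminorm nu -> 0 <= nu x.
Proof.
move=> nuP; have := seminorm_dist_triangle x 0 0 nuP.
by rewrite (seminorm_sym 0 x nuP) !subr0 seminorm0//; lra.
Qed.

Definition snorm_doubling nu D lam := forall (r : R) x, 0 <= r -> D x ->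
  exists y : 'I_lam -> V, (forall i, D (y i)) /\
    forall v, D v -> nu (x - v) <= 2 * r -> exists i, nu (y i - v) <= r.

Lemma doubling_iter nu D lam k (r : R) x : snorm_doubling nu D lam ->
  0 <= r -> D x -> exists y : 'I_(lam ^ k) -> V, (forall i, D (y i)) /\
    forall v, D v -> nu (x - v) <= 2 ^+ k * r -> exists i, nu (y i - v) <= r.
Proof.
move=> dbl r0 Dx.
suff [s [ss sD sc]] : exists s : seq V, [/\ size s = (lam ^ k)%N,
    forall i, (i < size s)%N -> D (nth 0 s i) &
    forall v, D v -> nu (x - v) <= 2 ^+ k * r ->
      exists2 i, (i < size s)%N & nu (nth 0 s i - v) <= r].
  exists (fun i => nth 0 s i); split=> [i|v Dv xv]; first by apply: sD; rewrite ss.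
  have [i si vi] := sc v Dv xv; rewrite ss in si.
  by exists (Ordinal si).
elim: k r r0 => [|k IH] r r0.
  exists [:: x]; split=> // [[]//|v Dv]; rewrite mul1r => xv.
  by exists 0%N.
have [|s [ss sD sc]] := IH (2 * r); first by rewrite mulr_ge0.
have /choice[f fP] : forall y, exists g : 'I_lam -> V, D y ->
    (forall i, D (g i)) /\
    forall v, D v -> nu (y - v) <= 2 * r -> exists i, nu (g i - v) <= r.
  move=> y; have [Dy|nDy] := pselect (D y); last by exists (fun=> 0).
  by have [g gP] := dbl r y r0 Dy; exists g.
have mem_s y : y \in s -> D y by move=> /(nthP 0)[i si <-]; exact: sD.
exists [seq f y i | y <- s, i <- enum 'I_lam]; split.
- by rewrite size_allpairs ss size_enum_ord expnSr.
- move=> i /(mem_nth 0) /allpairsP[[y j] /= [ys _ ->]].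
  by have [] := fP y (mem_s _ ys).
- move=> v Dv; rewrite exprSr -mulrA => xv.
  have [i si yv] := sc v Dv xv.
  have [_ /(_ v Dv yv) [j fj]] := fP _ (sD i si).
  have : f (nth 0 s i) j \in [seq f y i | y <- s, i <- enum 'I_lam].
    by apply/allpairsP; exists (nth 0 s i, j); rewrite /= mem_nth// mem_enum.
  by move=> /(nthP 0)[m ms fm]; exists m => //; rewrite fm.
Qed.

End Seminorm.

(** * Splitting a ball into slightly smaller balls *)

Section CellPartition.
Context (R : realType) (V H : lmodType R) (nu : V -> R) (b : H -> H -> R).
Context (nuP : seminorm nu) (bP : psd_form b).
Context (p : R) (p2 : 2 <= p) (M : V -> H).
Local Notation nrm x := (Num.sqrt (b x x)).
Hypothesis M_lip : forall u v, nu u <= 1 -> nu v <= 1 ->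
  nrm (M u - M v) <= p * nu (u - v).
Hypothesis M_shrink : forall u v, nu u <= 1 -> nu v <= 1 ->
  nrm (M u - M v) <= 10^-1 -> nu (v - p^-1 *: u) <= 1 - (24 * p)^-1.
Context (D : set V) (lam : nat) (lam2 : (2 <= lam)%N).
Hypothesis D_dbl : snorm_doubling nu D lam.

(** The partition is required only near [D]: the ball itself may have no finite net, while its
    points near [D] are covered through a net of [D]. *)
Definition near_in_ball (s : R) c Dl x :=
  (exists2 z, D z & nu (x - z) <= s) /\ nu (x - c) <= Dl.

(** 768 * 1000 = 256 * 500 * 6: the constant of [hilbert_partition], the inverse of the scale [del],
    and sqrt (ln (lam^k)) <= 6 sqrt (ln p * ln lam) for k <= 32 ln p. The factor p is the Lipschitz
    constant of the Mazur map. *)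
Definition cell_const : R := 768 * 1000 * (p * Num.sqrt (ln p * ln lam%:R)).

Lemma cover_exponent : exists k : nat, [/\ (0 < k)%N, k%:R <= 32 * ln p &
  8 * 1000 * p <= 2 ^+ k].
Proof.
have p_ge2 := p2; have p0 : 0 < p by lra.
have lnp : 2^-1 <= ln p by apply: le_trans (ln2_ge R) _; rewrite ler_ln ?posrE.
have x0 : 0 <= 30 * ln p by lra.
have /andP[kl ku] := truncn_itv x0.
set k := (Num.truncn _).+1 in ku.
have kle : k%:R <= 32 * ln p by rewrite /k -natr1; lra.
have k0 : (0 < k)%N by [].
clearbody k; clear kl; exists k; split=> //.
apply: (@le_trans _ _ (p ^+ 15)).
  have p14 : 2 ^+ 14 <= p ^+ 14 by rewrite lerXn2r ?nnegrE//; lra.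
  by rewrite exprSr ler_wpM2r//; [lra|apply: le_trans p14; lra].
rewrite -[X in X ^+ 15](lnK (_ : p \in Num.pos)) ?posrE//.
rewrite -[X in _ <= X ^+ k](lnK (_ : 2 \in Num.pos)) ?posrE// -!expRM_natr ler_expR.
have : 0 <= (ln 2 - 2^-1) * k%:R :> R by rewrite mulr_ge0// subr_ge0 ln2_ge.
lra.
Qed.

(* The image of the cell under the Mazur map is partitioned at a constant scale,
   so its net lives at scale about Dl / p and has lam ^ k points with 2 ^ k
   about p; this is the origin of the factor sqrt (ln p). *)
Lemma cell_partition (c : V) (Dl s : R) : 0 < Dl -> 0 <= s ->
  s <= Dl / (2 * 1000 * p) ->
  exists (J : finType) (w : V -> J -> R) (cc : J -> V),
  [/\ forall x j, 0 <= w x j,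
      forall x, near_in_ball s c Dl x -> \sum_j w x j = 1,
      forall x j, near_in_ball s c Dl x -> w x j != 0 ->
        nu (x - cc j) <= (1 - (24 * p)^-1) * Dl &
      forall x y, near_in_ball s c Dl x -> near_in_ball s c Dl y ->
        \sum_j `|w x j - w y j| <= cell_const / Dl * nu (x - y)].
Proof.
move=> Dl0 s0 s_le.
have tri y x z := seminorm_dist_triangle y x z nuP.
have sym x y := seminorm_sym x y nuP.
have nu0 x := seminorm_ge0 x nuP.
have [[x0 hx0]|nX] := pselect (exists x, near_in_ball s c Dl x); last first.
  exists void, (fun _ _ => 0), (fun=> 0).
  by split=> // [x hx|x y hx]; exfalso; apply: nX; exists x.
have [[y0 Dy0 xy0] x0c] := hx0.
have p_ge2 := p2; have p0 : 0 < p by lra.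
have [k [k0 k_le k_ge]] := cover_exponent.
(* The points of [D] concerned lie within 2 Dl + 2 s <= 4 Dl of [y0]; k halvings reach the radius
   [eta]. *)
pose eta := 4 * Dl / 2 ^+ k.
have k2 : 0 < 2 ^+ k :> R by rewrite exprn_gt0.
have eta0 : 0 <= eta by rewrite divr_ge0 ?mulr_ge0// ltW.
have eta_le : eta <= Dl / (2 * 1000 * p).
  rewrite /eta ler_pdivrMr//.
  have -> : Dl / (2 * 1000 * p) * 2 ^+ k = 4 * Dl * (2 ^+ k / (8 * 1000 * p)).
    by field; rewrite gt_eqF.
  have P0 : 0 < 8 * 1000 * p by lra.
  have Dl4 : 0 <= 4 * Dl by lra.
  by rewrite (ler_peMr Dl4) // (ler_pdivlMr _ _ P0) mul1r.
have sDl : s <= Dl / (4 * 1000).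
  apply: le_trans s_le _; rewrite (ler_wpM2l (ltW Dl0)) //.
  by rewrite lef_pV2 ?posrE; lra.
have [ys [Dys cov]] := doubling_iter k D_dbl eta0 Dy0.
(* The net points [ys] may lie outside the ball, where [M_lip] says nothing; each is replaced by a
   nearby admissible point of the ball, if there is one. *)
have /choice[xs xsP] : forall i, exists x, near_in_ball s c Dl x /\
    forall x', near_in_ball s c Dl x' -> nu (ys i - x') <= s + eta ->
      nu (ys i - x) <= s + eta.
  move=> i; have [[x [hx yx]]|hn] := pselect (exists x, near_in_ball s c Dl x /\
    nu (ys i - x) <= s + eta); first by exists x.
  exists x0; split=> //.
  by move=> x' hx' yx'; exfalso; apply: hn; exists x'.
pose m x := M (Dl^-1 *: (x - c)).
have scale_le x : nu (x - c) <= Dl -> nu (Dl^-1 *: (x - c)) <= 1.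
  case: nuP => _ nZ; rewrite nZ gtr0_norm ?invr_gt0// => xc.
  by rewrite mulrC ler_pdivrMr// mul1r.
have m_lip x y : nu (x - c) <= Dl -> nu (y - c) <= Dl ->
    nrm (m x - m y) <= p / Dl * nu (x - y).
  move=> xc yc; apply: le_trans (M_lip (scale_le _ xc) (scale_le _ yc)) _.
  rewrite -scalerBr opprB addrA subrK; case: nuP => _ ->.
  by rewrite gtr0_norm ?invr_gt0// mulrA.
(* Cells then have diameter at most 46/500 < 1/10, as [M_shrink] asks, and 2 (s + eta) p / Dl <=
   1/500 makes the images of the [xs] a [del]-net. *)
pose del : R := 500^-1.
have del0 : 0 < del by rewrite /del; lra.
pose N := (lam ^ k)%N.
have N2 : (2 <= N)%N.
  by apply: leq_trans lam2 _; rewrite -{1}(expn1 lam) leq_pexp2l// (ltn_trans _ lam2).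
have [J [w [w0 w1 wl ws]]] := hilbert_partition bP (fun i => m (xs i)) N2 del0.
have near x : near_in_ball s c Dl x ->
    exists i, nrm (m x - m (xs i)) <= del.
  move=> hx; have [[y Dy xy] xc] := hx.
  have yy0 : nu (y0 - y) <= 2 ^+ k * eta.
    rewrite /eta mulrC divfK ?gt_eqF//.
    have := tri x0 y0 y; have := tri c x0 y; have := tri x c y.
    by rewrite (sym y0 x0) (sym c x); lra.
  have [i yi] := cov y Dy yy0; exists i.
  have yix : nu (ys i - x) <= s + eta.
    by have := tri y (ys i) x; rewrite (sym y x); lra.
  have [[_ xsc] /(_ x hx yix) yixs] := xsP i.
  apply: le_trans (m_lip _ _ xc xsc) _.
  have h : nu (x - xs i) <= 2 * (s + eta).
    by have := tri (ys i) x (xs i); rewrite (sym x (ys i)); lra.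
  apply: (@le_trans _ _ (p / Dl * (2 * (Dl / (2 * 1000 * p) + Dl / (2 * 1000 * p))))).
    rewrite ler_wpM2l ?divr_ge0 ?(ltW p0) ?(ltW Dl0)//; lra.
  rewrite le_eqVlt; apply/orP; left; apply/eqP; rewrite /del; field.
  by rewrite !gt_eqF.
have /choice[xj xjP] : forall j, exists x, forall x', near_in_ball s c Dl x' ->
    w (m x') j != 0 -> near_in_ball s c Dl x /\ w (m x) j != 0.
  move=> j; have [[x [hx wx]]|hn] := pselect (exists x, near_in_ball s c Dl x /\
    w (m x) j != 0); first by exists x.
  by exists 0 => x' hx' wx'; exfalso; apply: hn; exists x'.
(* The new centre lies at the fraction 1/p of the way from c to an arbitrary point of the cell;
   after rescaling, x minus the new centre is the vector v - u / p of [M_shrink]. *)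
exists J, (fun x => w (m x)), (fun j => c + p^-1 *: (xj j - c)); split.
- by move=> x j; exact: w0.
- by move=> x /near /w1.
- move=> x j hx wx; have [[_ xjc] wxj] := xjP j x hx wx.
  have [_ xc] := hx.
  have hm : nrm (m (xj j) - m x) <= 10^-1.
    by apply: le_trans (ws _ _ _ wxj wx) _; rewrite /del; lra.
  have := M_shrink (scale_le _ xjc) (scale_le _ xc) hm.
  have -> : x - (c + p^-1 *: (xj j - c)) =
      Dl *: (Dl^-1 *: (x - c) - p^-1 *: (Dl^-1 *: (xj j - c))).
    rewrite [RHS]scalerBr !scalerA divff ?gt_eqF// scale1r mulrCA divff ?gt_eqF//.
    by rewrite mulr1 opprD addrA.
  case: nuP => _ ->; rewrite gtr0_norm// => h.
  by rewrite mulrC ler_wpM2r// ltW.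
- move=> x y hx hy; apply: le_trans (wl _ _ (near x hx) (near y hy)) _.
  have [_ xc] := hx; have [_ yc] := hy.
  apply: le_trans (ler_wpM2l _ (m_lip x y xc yc)) _.
    have L0 := sqrtr_ge0 (ln N%:R : R).
    by apply: mulr_ge0; [lra|rewrite invr_ge0 ltW].
  have lnp : 0 <= ln p by apply: ln_ge0; lra.
  have lnlam : 0 <= ln lam%:R :> R by apply: ln_ge0; rewrite ler1n (ltn_trans _ lam2).
  have lnN : Num.sqrt (ln N%:R) <= 6 * Num.sqrt (ln p * ln lam%:R).
    rewrite -[6]ger0_norm// -sqrtr_sqr -sqrtrM ?sqr_ge0// ler_wsqrtr//.
    rewrite /N natrX lnXn ?ltr0n ?(ltn_trans _ lam2)// -[leLHS]mulr_natl mulrA.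
    by rewrite ler_wpM2r//; lra.
  rewrite /cell_const /del !mulrA ler_wpM2r//.
  set S := Num.sqrt (ln p * _) in lnN *.
  have -> : 256 * Num.sqrt (ln N%:R) / 500^-1 * p / Dl =
    Num.sqrt (ln N%:R) * (128 * 1000 * (p / Dl)) by field; rewrite gt_eqF.
  have -> : 768 * 1000 * p * S / Dl = 6 * S * (128 * 1000 * (p / Dl)).
    by field; rewrite gt_eqF.
  have pD0 : 0 <= p / Dl by rewrite divr_ge0// ltW.
  have C0 : 0 <= 128 * 1000 * (p / Dl) by lra.
  exact: ler_wpM2r C0 _ _ lnN.
Qed.

End CellPartition.

(** * Local approximate extensions and the descent through the radii *)

Section LocalExtension.
Context (R : realType) (V : lmodType R) (nu : V -> R) (nuP : seminorm nu).
Context (D : set V) (Z : normedModType R) (f : V -> Z) (Lf : R).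
Hypothesis Lf0 : 0 <= Lf.
Hypothesis f_lip : forall z z', D z -> D z' -> `|f z - f z'| <= Lf * nu (z - z').

Let tri y x z := seminorm_dist_triangle y x z nuP.
Let sym x y := seminorm_sym x y nuP.
Let nu0 x := seminorm_ge0 x nuP.

(** [h] need not extend f: it may be off by Lf * E, with E eventually O(p s). The Lipschitz bound
    concerns pairs at distance at most s, for which one point of [D] near x serves y as well. *)
Definition approx_ext (s E K : R) (X : set V) (h : V -> Z) :=
  (forall x z, X x -> D z -> `|h x - f z| <= Lf * (nu (x - z) + E)) /\
  (forall x y, X x -> X y -> nu (x - y) <= s ->
     `|h x - h y| <= Lf * K * nu (x - y)).

(** Uniform in the centre c, since every step of the descent chooses new centres. *)
Definition local_ext s E Dl K :=
  forall c, exists h, approx_ext s E K (near_in_ball nu D s c Dl) h.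

Lemma approx_extW s E K K' X h : K <= K' -> approx_ext s E K X h ->
  approx_ext s E K' X h.
Proof.
move=> KK [h1 h2]; split=> // x y hx hy xy.
by apply: le_trans (h2 x y hx hy xy) _; rewrite ler_wpM2r// ler_wpM2l.
Qed.

Lemma local_ext_small s Dl : 0 <= s -> local_ext s (2 * Dl + s) Dl 0.
Proof.
move=> s0 c.
have [[x0 hx0]|nX] := pselect (exists x, near_in_ball nu D s c Dl x); last first.
  by exists (fun=> 0); split=> [x z hx|x y hx]; exfalso; apply: nX; exists x.
have [[z0 Dz0 xz0] x0c] := hx0.
exists (fun=> f z0); split=> [x z [_ xc] Dz|x y _ _ _]; last first.
  by rewrite subrr normr0 mulr0 mul0r.
apply: le_trans (f_lip Dz0 Dz) _; apply: ler_wpM2l => //.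
have := tri x0 z0 z; have := tri c x0 z; have := tri x c z.
by rewrite (sym z0 x0) (sym c x); lra.
Qed.

(** All values involved lie within Lf * (2 s + E) of f at one point z near x. The variation of the
    weights is multiplied by this number alone, so gluing adds B (2 s + E) to K. *)
Lemma glue_approx_ext (J : Type) (r : seq J) (wx wy : J -> R) (hx hy : J -> Z)
    (s E K B : R) (x y : V) :
  0 <= s -> 0 <= E -> 0 <= K ->
  (exists2 z, D z & nu (x - z) <= s) -> nu (x - y) <= s ->
  (forall j, 0 <= wx j) -> (forall j, 0 <= wy j) ->
  \sum_(j <- r) wx j = 1 -> \sum_(j <- r) wy j = 1 ->
  (forall j z, wx j != 0 -> D z -> `|hx j - f z| <= Lf * (nu (x - z) + E)) ->
  (forall j z, wy j != 0 -> D z -> `|hy j - f z| <= Lf * (nu (y - z) + E)) ->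
  (forall j, wx j != 0 -> wy j != 0 -> `|hx j - hy j| <= Lf * K * nu (x - y)) ->
  \sum_(j <- r) `|wx j - wy j| <= B * nu (x - y) ->
  `|\sum_(j <- r) wx j *: hx j - \sum_(j <- r) wy j *: hy j| <=
    Lf * (K + B * (2 * s + E)) * nu (x - y).
Proof.
move=> s0 E0 K0 [z Dz xz] xy wx0 wy0 wx1 wy1 hxz hyz hxy wxy.
have xz2 j : wx j != 0 -> `|hx j - f z| <= Lf * (2 * s + E).
  by move=> /hxz/(_ Dz)/le_trans; apply; rewrite ler_wpM2l//; lra.
have yz2 j : wy j != 0 -> `|hy j - f z| <= Lf * (2 * s + E).
  move=> /hyz/(_ Dz)/le_trans; apply; rewrite ler_wpM2l//.
  by have := tri x y z; rewrite (sym y x); lra.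
apply: le_trans (convex_combinations_dist wx0 wy0 wx1 wy1 _ xz2 yz2 hxy) _.
  by rewrite !mulr_ge0.
have -> : Lf * (K + B * (2 * s + E)) * nu (x - y) =
  Lf * K * nu (x - y) + Lf * (2 * s + E) * (B * nu (x - y)) by ring.
by rewrite lerD2l ler_wpM2l// mulr_ge0//; lra.
Qed.

Section Iterate.
Context (H : lmodType R) (b : H -> H -> R) (bP : psd_form b).
Context (p : R) (p2 : 2 <= p) (M : V -> H).
Local Notation nrm x := (Num.sqrt (b x x)).
Hypothesis M_lip : forall u v, nu u <= 1 -> nu v <= 1 ->
  nrm (M u - M v) <= p * nu (u - v).
Hypothesis M_shrink : forall u v, nu u <= 1 -> nu v <= 1 ->
  nrm (M u - M v) <= 10^-1 -> nu (v - p^-1 *: u) <= 1 - (24 * p)^-1.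
Context (lam : nat) (lam2 : (2 <= lam)%N).
Hypothesis D_dbl : snorm_doubling nu D lam.
Local Notation Kc := (cell_const p lam).

Lemma cell_const_ge0 : 0 <= Kc.
Proof.
have p_ge2 := p2.
have S0 : 0 <= p * Num.sqrt (ln p * ln lam%:R).
  by rewrite mulr_ge0 ?sqrtr_ge0//; lra.
by rewrite /cell_const; lra.
Qed.

(** Averaging leaves the error E unchanged, so the increment of K depends on the scale only through
    1 / Dl. *)
Lemma local_ext_step s E Dl K : 0 <= s -> 0 < Dl ->
  s <= Dl / (2 * 1000 * p) -> 0 <= E -> 0 <= K ->
  local_ext s E ((1 - (24 * p)^-1) * Dl) K ->
  local_ext s E Dl (K + Kc / Dl * (2 * s + E)).
Proof.
move=> s0 Dl0 s_le E0 K0 hloc c.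
have [J [w [cc [w0 w1 wc wl]]]] :=
  cell_partition nuP bP p2 M_lip M_shrink lam2 D_dbl c Dl0 s0 s_le.
have /choice[h hP] := hloc.
have near_cc x j : near_in_ball nu D s c Dl x -> w x j != 0 ->
    near_in_ball nu D s (cc j) ((1 - (24 * p)^-1) * Dl) x.
  by move=> hx wx; split; [case: hx|exact: wc].
exists (fun x => \sum_j w x j *: h (cc j) x); split=> [x z hx Dz|x y hx hy xy].
  apply: convex_combination_dist => [//||j wxj]; first exact: w1.
  by have [h1 _] := hP (cc j); apply: h1 => //; exact: near_cc.
apply: (@glue_approx_ext _ _ _ _ _ _ s) => //.
- by case: hx.
- exact: w1.
- exact: w1.
- move=> j z wxj Dz; have [h1 _] := hP (cc j).
  by apply: h1 => //; exact: near_cc.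
- move=> j z wxj Dz; have [h1 _] := hP (cc j).
  by apply: h1 => //; exact: near_cc.
- move=> j wxj wyj; have [_ h2] := hP (cc j).
  by apply: h2 => //; exact: near_cc.
- exact: wl.
Qed.

(* The errors cell_const / Dl of successive scales form a geometric series of
   ratio 1 - 1/(24p), whose sum is at most 24 p times the last term. *)
Lemma local_ext_large s (T : R) : 0 < s -> exists2 Dl, T <= Dl &
  local_ext s (2 * (2 * 1000 * p * s) + s) Dl (72 * p * Kc).
Proof.
move=> s0; have p_ge2 := p2; have Kc0 := cell_const_ge0.
have p0 : 0 < p by lra.
(* The smallest radius that [cell_partition] accepts; below it f is replaced by a constant. *)
set D0 := 2 * 1000 * p * s; set E := 2 * D0 + s.
have D00 : 0 < D0.
  by have : 0 < p * s := mulr_gt0 p0 s0; rewrite /D0; lra.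
have sD0 : s <= D0 / (2 * 1000 * p).
  have P0 : 0 < 2 * 1000 * p by lra.
  by rewrite (ler_pdivlMr _ _ P0) /D0 mulrC.
have E0 : 0 <= E by rewrite /E; lra.
have E_small : 2 * s + E <= 3 * D0.
  have : 4 * s <= 2 * s * p by rewrite mulrAC; apply: ler_wpM2r; lra.
  by rewrite /E /D0; lra.
have small0 : local_ext s E D0 0 by apply: local_ext_small; exact: ltW.
clearbody E D0.
set rho := 1 - (24 * p)^-1.
have ip : 0 < (24 * p)^-1 by rewrite invr_gt0; lra.
have ip1 : (24 * p)^-1 <= 48^-1 by rewrite lef_pV2 ?posrE; lra.
have rho0 : 0 < rho by rewrite /rho; lra.
have rho1 : rho < 1 by rewrite /rho; lra.
(* Chosen with A (1 - rho) = Kc (2 s + E), so that A (1 / D0 - 1 / Dl) telescopes and dominates the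
   accumulated cost. *)
pose A := 24 * p * (Kc * (2 * s + E)).
have [c24 s2E] : 0 <= 24 * p /\ 0 <= 2 * s + E by split; lra.
have A0 : 0 <= A by rewrite mulr_ge0// mulr_ge0.
have AD0 : A / D0 <= 72 * p * Kc.
  rewrite ler_pdivrMr//.
  have -> : 72 * p * Kc * D0 = 24 * p * (Kc * (3 * D0)) by ring.
  by apply: ler_wpM2l => //; exact: ler_wpM2l.
have AE : A * (1 - rho) = Kc * (2 * s + E).
  have P24 : 24 * p != 0 by rewrite gt_eqF//; lra.
  by rewrite /rho opprB addrC subrK /A mulrAC divff// mul1r.
have rhoE : 1 - (24 * p)^-1 = rho by [].
clearbody rho A.
have iter n : let Dl := D0 / rho ^+ n in
    local_ext s E Dl (A * (D0^-1 - Dl^-1)).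
  elim: n => [|n IH] /=.
    by rewrite expr0 divr1 subrr mulr0.
  have rn : 0 < rho ^+ n by rewrite exprn_gt0.
  set Dl := D0 / rho ^+ n.+1.
  have Dl0 : 0 < Dl by rewrite divr_gt0// exprn_gt0.
  have DlE : rho * Dl = D0 / rho ^+ n.
    by rewrite /Dl exprS; field; rewrite !gt_eqF.
  have D0Dl : D0 <= rho * Dl.
    rewrite DlE ler_pdivlMr// ler_piMr ?(ltW D00)// exprn_ile1 ?(ltW rho0)//.
    exact: ltW.
  have D0Dl' : D0 <= Dl by apply: le_trans D0Dl _; rewrite ler_piMl ?ltW.
  move: IH; rewrite /= -DlE => IH c.
  have sDl : s <= Dl / (2 * 1000 * p).
    have iP : 0 <= (2 * 1000 * p)^-1 by rewrite invr_ge0; lra.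
    exact: le_trans sD0 (ler_wpM2r iP D0Dl').
  have rDl0 : 0 < rho * Dl by rewrite mulr_gt0.
  have K0 : 0 <= A * (D0^-1 - (rho * Dl)^-1).
    by rewrite mulr_ge0// subr_ge0 lef_pV2.
  rewrite -{1}rhoE in IH.
  have [h hP] := local_ext_step (ltW s0) Dl0 sDl E0 K0 IH c.
  exists h; apply: approx_extW hP.
  have -> : Kc / Dl * (2 * s + E) = A * (1 - rho) / Dl by rewrite AE mulrAC.
  rewrite -subr_ge0.
  have -> : A * (D0^-1 - Dl^-1) - (A * (D0^-1 - (rho * Dl)^-1) + A * (1 - rho) / Dl)
     = A * (1 - rho) ^+ 2 / (rho * Dl) by field; rewrite !gt_eqF.
  exact: divr_ge0 (mulr_ge0 A0 (sqr_ge0 _)) (ltW rDl0).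
have [n hn] : exists n, T <= D0 / rho ^+ n.
  have [n hn] : exists n : nat, T / D0 <= n%:R.
    by exists (Num.truncn (`|T / D0|)).+1; apply: le_trans (ler_norm _) _;
      have /andP[_ /ltW] := truncn_itv (normr_ge0 (T / D0)).
  (* Bernoulli's inequality: the radii D0 / rho^n are unbounded. *)
  have bern m : 1 + m%:R * (rho^-1 - 1) <= rho^-1 ^+ m.
    have r1 : 1 <= rho^-1 by rewrite invf_ge1// ltW.
    elim: m => [|m IHm]; first by rewrite mul0r addr0 expr0.
    rewrite exprS -natr1.
    have := ler_wpM2l (ltW (lt_le_trans ltr01 r1)) IHm.
    have : 0 <= m%:R * (rho^-1 - 1) ^+ 2 by rewrite mulr_ge0// sqr_ge0.
    by move: (rho^-1) (rho^-1 ^+ m) => y z; lra.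
  have dr : 0 < rho^-1 - 1 by rewrite subr_gt0 invf_gt1.
  have [m hm] : exists m : nat, n%:R / (rho^-1 - 1) <= m%:R.
    exists (Num.truncn (n%:R / (rho^-1 - 1))).+1.
    by have /andP[_ /ltW] := truncn_itv (divr_ge0 (ler0n R n) (ltW dr)).
  exists m; rewrite -exprVn mulrC -ler_pdivrMr//.
  apply: le_trans hn _; apply: le_trans (bern m).
  by move: hm; rewrite ler_pdivrMr//; lra.
exists (D0 / rho ^+ n) => // c; have [h hP] := iter n c; exists h.
apply: approx_extW hP.
have Dl0 : 0 < D0 / rho ^+ n by rewrite divr_gt0// exprn_gt0.
apply: (@le_trans _ _ (A / D0)).
  by rewrite ler_wpM2l// gerBl invr_ge0 ltW.
exact: AD0.
Qed.

End Iterate.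
End LocalExtension.

(** * From large balls to the whole neighbourhood of D *)

Section CoarseScale.
Context (R : realType) (V : lmodType R) (nu : V -> R) (nuP : seminorm nu).
Context (D : set V) (lam : nat) (D_dbl : snorm_doubling nu D lam).

Let tri y x z := seminorm_dist_triangle y x z nuP.
Let sym x y := seminorm_sym x y nuP.
Let nu0 x := seminorm_ge0 x nuP.

Lemma separated_net a : 0 <= a -> exists S : set V,
  [/\ S `<=` D, forall z z', S z -> S z' -> nu (z - z') <= a -> z = z' &
      forall v, D v -> exists2 z, S z & nu (v - z) <= a].
Proof.
move=> a0.
pose P (S : set V) := S `<=` D /\
  forall z z', S z -> S z' -> nu (z - z') <= a -> z = z'.
have [|S [[SD Ssep] Smax]] := @Zorn_bigcup _ P.
  move=> F FP Ftot; split=> [z [X FX Xz]|z z' [X FX Xz] [Y FY Yz'] zz'].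
    by have [XD _] := FP X FX; exact: XD.
  have [XY|YX] := Ftot X Y FX FY.
    by have [_ sep] := FP Y FY; apply: sep => //; exact: XY.
  by have [_ sep] := FP X FX; apply: sep => //; exact: YX.
exists S; split=> // v Dv; apply: contrapT => hn.
have far z : S z -> ~ nu (v - z) <= a by move=> Sz vz; apply: hn; exists z.
apply: (Smax (S `|` [set v])).
  split=> [z Sz|h]; first by left.
  by apply: (far v); [apply: h; right|rewrite subrr seminorm0].
split=> [z [/SD//|->//]|z z' [Sz|->] [Sz'|->]//].
- exact: Ssep.
- by rewrite sym => /(far z Sz).
- by move=> /(far z' Sz').
Qed.

Lemma separated_near_finite a (S : set V) x : 0 < a -> S `<=` D ->
  (forall z z', S z -> S z' -> nu (z - z') <= a -> z = z') ->
  exists t : seq V, [/\ uniq t, (size t <= lam ^ 4)%N &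
    forall z, (z \in t) <-> S z /\ nu (x - z) < 4 * a].
Proof.
move=> a0 SD Ssep.
have [[z0 [Sz0 xz0]]|nX] := pselect (exists z, S z /\ nu (x - z) < 4 * a); last first.
  exists [::]; split=> // z; split=> // hz; exfalso; apply: nX; by exists z.
have a20 : 0 <= a / 2 by lra.
have [y [_ cov]] := doubling_iter 4 D_dbl a20 (SD _ Sz0).
pose A z := S z /\ nu (x - z) < 4 * a.
have /choice[k kP] : forall i, exists v, forall z, A z -> nu (y i - z) <= a / 2 ->
    A v /\ nu (y i - v) <= a / 2.
  move=> i; have [[v hv]|hn] := pselect (exists v, A v /\ nu (y i - v) <= a / 2).
    by exists v.
  by exists 0 => z Az yz; exfalso; apply: hn; exists z.
exists (undup [seq v <- [seq k i | i <- enum 'I_(lam ^ 4)] | `[< A v >]]); split.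
- exact: undup_uniq.
- apply: leq_trans (size_undup _) _; rewrite size_filter.
  by apply: leq_trans (count_size _ _) _; rewrite size_map size_enum_ord.
- move=> z; rewrite mem_undup mem_filter; split=> [/andP[/asboolP//]|Az].
  apply/andP; split; first exact/asboolP.
  have zz0 : nu (z0 - z) <= 2 ^+ 4 * (a / 2).
    have := tri x z0 z; rewrite (sym z0 x).
    by case: Az => _; lra.
  have [i yz] := cov z (SD _ Az.1) zz0.
  have [[Sk _] yk] := kP i z Az yz.
  apply/mapP; exists i; first by rewrite mem_enum.
  apply: Ssep => //; first exact: Az.1.
  by have := tri (y i) z (k i); rewrite (sym z (y i)); lra.
Qed.

(** The list of net points is chosen separately at each x, whereas gluing sums over a single
    list. *)
Lemma eq_big_uniq_support (U : nmodType) (t t' : seq V) (P : pred V) (G : V -> U) :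
  uniq t -> uniq t' -> (forall z, P z -> (z \in t) = (z \in t')) ->
  (forall z, ~~ P z -> G z = 0) ->
  \sum_(z <- t) G z = \sum_(z <- t') G z.
Proof.
move=> ut ut' tt' G0.
rewrite (bigID P) [RHS](bigID P) /= [X in _ + X]big1 // [X in _ = _ + X]big1 //.
rewrite !addr0 -[LHS]big_filter -[RHS]big_filter; apply: perm_big.
apply: uniq_perm; rewrite ?filter_uniq// => z; rewrite !mem_filter.
by have [/tt'->|] := boolP (P z).
Qed.

Context (Z : normedModType R) (f : V -> Z) (Lf : R).
Hypothesis Lf0 : 0 <= Lf.

(* The tents around a net contribute to the Lipschitz constant a quantity that
   depends on lam but is divided by the mesh a, which is at our disposal. *)
Lemma global_approx_ext (s E K : R) : 0 < s -> 0 <= E -> 0 <= K ->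
  (forall T, exists2 Dl, T <= Dl & local_ext nu D f Lf s E Dl K) ->
  exists h, approx_ext nu D f Lf s E (K + 1)
    [set x | exists2 z, D z & nu (x - z) <= s] h.
Proof.
move=> s0 E0 K0 hloc.
pose n4 : R := (lam ^ 4)%:R.
have n40 : 0 <= n4 by [].
(* Makes 2 n4 (2 s + E) / a at most 1, the final increment of K, and keeps a >= s. *)
pose a := s + 2 * n4 * (2 * s + E).
have sa : s <= a by rewrite lerDl mulr_ge0 ?mulr_ge0//; lra.
have a0 : 0 < a by exact: lt_le_trans sa.
have [S [SD Ssep Snet]] := separated_net (ltW a0).
have /choice[t tP] := fun x => separated_near_finite x a0 SD Ssep.
have [Dl aDl hDl] := hloc (3 * a).
have /choice[h hP] := hDl.
(* A point near [D] is within 2 a of the net, so some tent is at least a there. A tent of radius 3 a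
   that is active at y is listed at every x within s <= a of y, as the lists reach to 4 a. *)
pose psi z x := Num.max (3 * a - nu (x - z)) 0.
have psi0 z x : 0 <= psi z x by rewrite le_max lexx orbT.
have psi_supp z x : psi z x != 0 -> nu (x - z) < 3 * a.
  by rewrite /psi; case: (leP (3 * a - _)) => [_|]; rewrite ?eqxx//; lra.
have psi_lip z x y : `|psi z x - psi z y| <= nu (x - y).
  have h1 := tri x y z; have h2 := tri y x z; rewrite (sym y x) in h1.
  rewrite /psi; case: (leP (3 * a - nu (x - z))) => ?;
    case: (leP (3 * a - nu (y - z))) => ?; rewrite ler_norml; apply/andP; split;
    by have := nu0 (x - y); lra.
pose W x := \sum_(z <- t x) psi z x.
pose N x := exists2 z, D z & nu (x - z) <= s.
have W_ge x : N x -> a <= W x.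
  move=> [v Dv xv]; have [z Sz vz] := Snet v Dv.
  have xz : nu (x - z) <= 2 * a by have := tri v x z; lra.
  have [ut _ mt] := tP x.
  have zt : z \in t x by apply/mt; split=> //; lra.
  rewrite /W (big_rem z zt) /=.
  have pz : a <= psi z x by rewrite le_max; apply/orP; left; lra.
  have : 0 <= \sum_(y <- rem z (t x)) psi y x by exact: sumr_ge0.
  by lra.
have W0 x : N x -> 0 < W x by move=> /W_ge; exact: lt_le_trans.
have near_t z x y : psi z y != 0 -> nu (x - y) <= s -> (z \in t x) = (z \in t y).
  move=> /psi_supp yz xy; have [_ _ mx] := tP x; have [_ _ my] := tP y.
  apply/idP/idP => [/mx[Sz _]|/my[Sz _]].
    by apply/my; split=> //; lra.
  by apply/mx; split=> //; have := tri y x z; lra.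
have change (U : nmodType) (G : V -> U) x y : nu (x - y) <= s ->
    (forall z, psi z y = 0 -> G z = 0) -> \sum_(z <- t y) G z = \sum_(z <- t x) G z.
  move=> xy G0; have [ux _ _] := tP x; have [uy _ _] := tP y.
  apply: (@eq_big_uniq_support _ _ _ (fun z => psi z y != 0)) => // [z zy|z].
    by rewrite (near_t z x y).
  by rewrite negbK => /eqP/G0.
have hcell x z : N x -> psi z x / W x != 0 -> near_in_ball nu D s z Dl x.
  move=> Nx; rewrite mulf_eq0 negb_or => /andP[/psi_supp xz _].
  by split=> //; lra.
exists (fun x => \sum_(z <- t x) (psi z x / W x) *: h z x).
have w1 x : N x -> \sum_(z <- t x) psi z x / W x = 1.
  by move=> /W0 Wx; rewrite -mulr_suml divff// gt_eqF.
have w0 x z : N x -> 0 <= psi z x / W x by move=> /W0/ltW Wx; rewrite divr_ge0.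
split=> [x z Nx Dz|x y Nx Ny xy].
  apply: convex_combination_dist => [z'||z' wz']; [exact: w0|exact: w1|].
  by have [h1 _] := hP z'; apply: h1 => //; exact: hcell.
rewrite (change _ _ x y xy); last first.
  by move=> z ->; rewrite mul0r scale0r.
have Wy : W y = \sum_(z <- t x) psi z y by exact: change.
apply: le_trans (_ : _ <= Lf * (K + 2 * n4 / a * (2 * s + E)) * nu (x - y)) _;
  last first.
  rewrite ler_wpM2r// ler_wpM2l// lerD2l mulrAC ler_pdivrMr// mul1r.
  by rewrite /a lerDr ltW.
apply: (glue_approx_ext nuP Lf0 (ltW s0) E0 K0 Nx xy) => //.
- by move=> z; exact: w0.
- by move=> z; exact: w0.
- exact: w1.
- by rewrite -mulr_suml -Wy divff// gt_eqF// W0.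
- move=> z v wz Dv; have [h1 _] := hP z; apply: h1 => //; exact: hcell.
- move=> z v wz Dv; have [h1 _] := hP z; apply: h1 => //; exact: hcell.
- move=> z wz wz'; have [_ h2] := hP z; apply: h2 => //; exact: hcell.
- rewrite Wy.
  have Wx0 := W0 _ Nx; have Wy0 := W0 _ Ny; rewrite Wy in Wy0.
  apply: le_trans (normalized_weights_le _ _ Wx0 Wy0) _ => //.
  rewrite -/(W x) ler_pdivrMr//.
  apply: (@le_trans _ _ (2 * (n4 * nu (x - y)))).
    rewrite ler_pM2l//.
    apply: le_trans (ler_sum _ (fun z _ => psi_lip z x y)) _.
    rewrite big_const_seq count_predT iter_addr_0 -[leLHS]mulr_natl.
    by rewrite ler_wpM2r// ler_nat; have [] := tP x.
  have -> : 2 * (n4 * nu (x - y)) = 2 * n4 / a * nu (x - y) * a.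
    by field; rewrite gt_eqF.
  rewrite ler_wpM2l ?W_ge// mulr_ge0// divr_ge0 ?mulr_ge0//; exact: ltW.
Qed.

End CoarseScale.

(** * Interpolation between scales *)

Section WhitneyInterpolation.
Context (R : realType).

(** [sc r] is the largest power of 2, with an integer exponent, not exceeding r. *)
Lemma dyadic_scale : exists sc : R -> R,
  (forall r, 0 < r -> [/\ 0 < sc r, sc r <= r & r < 2 * sc r]) /\
  (forall r r', 0 < r -> r <= r' -> r' <= 2 * r ->
     sc r' = sc r \/ sc r' = 2 * sc r).
Proof.
have l2 : 0 < ln 2 :> R by apply: lt_le_trans (ln2_ge R); lra.
have l2n : ln 2 != 0 :> R by rewrite gt_eqF.
pose fl (r : R) : int := Num.floor (ln r / ln 2).
pose sc (r : R) : R := expR (ln 2 * (fl r)%:~R).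
have flP r : (fl r)%:~R <= ln r / ln 2 /\ ln r / ln 2 < (fl r)%:~R + 1.
  by split; [exact: Num.Theory.floor_le|rewrite -[1]/(1%:~R) -intrD; exact: floorD1_gt].
have scS r r' : (fl r' = fl r + 1)%R -> sc r' = 2 * sc r.
  move=> e; rewrite /sc e intrD mulrDr mulr1 expRD lnK ?posrE// mulrC//.
exists sc; split=> [r r0|r r' r0 rr' r'2].
  have [f1 f2] := flP r; rewrite expR_gt0.
  have rE : r = expR (ln 2 * (ln r / ln 2)).
    by rewrite mulrCA divff// mulr1 lnK.
  split=> //; first by rewrite {2}rE ler_expR ler_pM2l.
  have -> : 2 * sc r = expR (ln 2 * ((fl r)%:~R + 1)).
    by rewrite mulrDr mulr1 expRD lnK ?posrE// mulrC.
  by rewrite {1}rE ltr_expR ltr_pM2l.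
have r'0 : 0 < r' by exact: lt_le_trans rr'.
have h1 : ln r / ln 2 <= ln r' / ln 2 by rewrite ler_pM2r ?invr_gt0// ler_ln.
have h2 : ln r' / ln 2 <= ln r / ln 2 + 1.
  rewrite -[X in _ <= _ + X](divff l2n) -mulrDl ler_pM2r ?invr_gt0//.
  rewrite addrC -lnM ?posrE//.
  by rewrite ler_ln ?posrE// mulr_gt0.
have [f1 f2] := flP r; have [f1' f2'] := flP r'.
have lb : fl r < fl r' + 1 by rewrite -(ltr_int R) intrD; lra.
have ub : fl r' < fl r + 2 by rewrite -(ltr_int R) intrD; lra.
have [e|e] : fl r' = fl r \/ fl r' = fl r + 1.
  by clear -lb ub; move: (fl r) (fl r') lb ub => i j; lia.
  by left; rewrite /sc e.
by right; exact: scS.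
Qed.

Context (V : lmodType R) (nu : V -> R) (nuP : seminorm nu).
Context (D : set V) (D0 : D !=set0).

Let tri y x z := seminorm_dist_triangle y x z nuP.
Let sym x y := seminorm_sym x y nuP.
Let nu0 x := seminorm_ge0 x nuP.

Definition dist_to x := inf [set nu (x - z) | z in D].

Lemma dist_to_le x z : D z -> dist_to x <= nu (x - z).
Proof.
move=> Dz; apply: ge_inf; last by exists z.
by exists 0 => _ [v _ <-]; exact: nu0.
Qed.

Lemma dist_to_ge0 x : 0 <= dist_to x.
Proof.
apply: lb_le_inf; last by move=> _ [v _ <-]; exact: nu0.
by have [z Dz] := D0; exists (nu (x - z)), z.
Qed.

Lemma dist_to_lt x r : dist_to x < r -> exists2 z, D z & nu (x - z) <= r.
Proof.
move=> xr; have [||_ [z Dz <-] xz] :=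
  @inf_adherent _ [set nu (x - z) | z in D] (r - dist_to x).
- by rewrite subr_gt0.
- split; first by have [z Dz] := D0; exists (nu (x - z)), z.
  by exists 0 => _ [v _ <-]; exact: nu0.
- by exists z => //; move: xz; rewrite -/(dist_to x); lra.
Qed.

Lemma dist_to_lip x y : dist_to x <= dist_to y + nu (x - y).
Proof.
apply/ler_addgt0Pr => e e0.
have [|z Dz yz] := @dist_to_lt y (dist_to y + e); first by lra.
by have := dist_to_le x Dz; have := tri y x z; lra.
Qed.

Context (Z : completeNormedModType R) (f : V -> Z) (Lf : R).
Hypothesis Lf0 : 0 <= Lf.
Hypothesis f_lip : forall z z', D z -> D z' -> `|f z - f z'| <= Lf * nu (z - z').

Lemma closure_value x : dist_to x = 0 ->
  exists v : Z, forall z, D z -> `|v - f z| <= Lf * nu (x - z).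
Proof.
move=> x0.
have /choice[zs zsP] : forall n : nat, exists z, D z /\ nu (x - z) <= n.+1%:R^-1.
  by move=> n; have [|z Dz xz] := @dist_to_lt x n.+1%:R^-1; [rewrite x0|exists z].
pose u n := f (zs n).
have u_lip n z : D z -> `|u n - f z| <= Lf * (n.+1%:R^-1 + nu (x - z)).
  move=> Dz; have [Dn xn] := zsP n; apply: le_trans (f_lip Dn Dz) _.
  rewrite ler_wpM2l//; have := tri x (zs n) z; rewrite (sym (zs n) x).
  by move: xn; move: (n.+1%:R^-1) => q; lra.
have small e : 0 < e -> exists n : nat, forall m, (n <= m)%N -> Lf * m.+1%:R^-1 <= e.
  move=> e0; exists (Num.truncn (Lf / e)) => m nm.
  rewrite ler_pdivrMr// mulrC -ler_pdivrMr//.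
  have /andP[_ /ltW h] := truncn_itv (divr_ge0 Lf0 (ltW e0)).
  by apply: le_trans h _; rewrite ler_nat.
have cu : cvg (u n @[n --> \oo]).
  apply/cauchy_cvgP/cauchy_exP => e e0.
  have [|n hn] := small (e / 4); first by lra.
  exists (u n); exists n => // m /= nm.
  rewrite -ball_normE /=; have [Dm xm] := zsP m.
  apply: le_lt_trans (u_lip n _ Dm) _; rewrite mulrDr.
  move: (hn n (leqnn n)) (hn m nm) (ler_wpM2l Lf0 xm).
  by move: (n.+1%:R^-1) (m.+1%:R^-1) => q q'; lra.
exists (limn u) => z Dz; apply/ler_addgt0Pr => e e0.
have [|n hn] := small (e / 2); first by lra.
have : \forall m \near \oo, `|limn u - u m| < e / 2.
  by move/cvgrPdist_lt : cu; apply; lra.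
move=> [m _ hm]; pose k := maxn n m.
have h1 : `|limn u - u k| < e / 2 by apply: hm; exact: leq_maxr.
have h2 := u_lip k z Dz; have h3 := hn k (leq_maxl _ _).
apply: le_trans (ler_distD (u k) _ _) _; rewrite mulrDr in h2.
by move: h2 h3; move: (k.+1%:R^-1) => q; lra.
Qed.

(** The difference is (1 - t)(a - c) + t (b - d) + (t' - t)(c - d), so the gap between consecutive
    scales counts only in proportion to the change of the parameter. *)
Lemma interpolation_dist (a b c d : Z) (t t' A B : R) :
  0 <= t <= 1 -> `|a - c| <= A -> `|b - d| <= A -> `|c - d| <= B ->
  `|(1 - t) *: a + t *: b - ((1 - t') *: c + t' *: d)| <= A + `|t' - t| * B.
Proof.
move=> /andP[t0 t1] ac bd cd.
have -> : (1 - t) *: a + t *: b - ((1 - t') *: c + t' *: d) =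
    (1 - t) *: (a - c) + t *: (b - d) + (t' - t) *: (c - d).
  pose y := (1 - t) *: c + t *: d.
  have -> : (t' - t) *: (c - d) = y - ((1 - t') *: c + t' *: d).
    rewrite opprD addrACA -!scalerBl scalerBr -scaleNr.
    by congr (_ *: _ + _ *: _); ring.
  have -> : (1 - t) *: (a - c) + t *: (b - d) = (1 - t) *: a + t *: b - y.
    by rewrite /y opprD addrACA -!scalerBr.
  by rewrite addrA subrK.
apply: le_trans (ler_normD _ _) _; rewrite normrZ; apply: lerD; last first.
  by rewrite ler_wpM2l.
have t1' : 0 <= 1 - t by rewrite subr_ge0.
apply: le_trans (ler_normD _ _) _; rewrite !normrZ (ger0_norm t0) (ger0_norm t1').
by have := ler_wpM2l t1' ac; have := ler_wpM2l t0 bd; lra.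
Qed.

(* An extension that is good at distance about s from D is interpolated
   linearly between the dyadic scales; on the closure of D completeness of the
   target provides the values. *)
Lemma whitney_extension (K G : R) : 0 <= K -> 0 <= G ->
  (forall s, 0 < s -> exists h, approx_ext nu D f Lf s (G * s) K
    [set x | exists2 z, D z & nu (x - z) <= s] h) ->
  exists F : V -> Z, (forall z, D z -> F z = f z) /\
    forall x y, `|F x - F y| <= Lf * (K + 128 * (1 + G)) * nu (x - y).
Proof.
move=> K0 G0 hs; have Lf_ge0 := Lf0.
have /choice[h hP] : forall s, exists h, 0 < s -> approx_ext nu D f Lf s (G * s) K
    [set x | exists2 z, D z & nu (x - z) <= s] h.
  by move=> s; have [/hs[h hh]|s0] := ltP 0 s; [exists h|exists (fun=> 0)].
have /choice[v vP] : forall x, exists v : Z, dist_to x = 0 ->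
    forall z, D z -> `|v - f z| <= Lf * nu (x - z).
  move=> x; have [/closure_value[v hv]|x0] := pselect (dist_to x = 0).
    by exists v.
  by exists 0.
have [sc [scP scS]] := dyadic_scale.
(* [th] runs from 0 to 1 over a dyadic interval, so the formulas for F agree where the scale
   doubles. The 8 leaves room for both interpolated scales and for nearby points. *)
pose th x := dist_to x / sc (dist_to x) - 1.
pose g s x := h (8 * s) x.
pose F x := if dist_to x == 0 then v x else
  (1 - th x) *: g (sc (dist_to x)) x + th x *: g (2 * sc (dist_to x)) x.
have r0 x : dist_to x != 0 -> 0 < dist_to x.
  by move=> xn; rewrite lt_neqAle eq_sym xn dist_to_ge0.
have thP x : 0 < dist_to x -> 0 <= th x <= 1.
  move=> /scP[s0 h1 h2]; rewrite /th subr_ge0 ler_pdivlMr// mul1r h1 /=.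
  by rewrite lerBlDr ler_pdivrMr//; lra.
have g_val s x z : 0 < s -> dist_to x < 8 * s -> D z ->
    `|g s x - f z| <= Lf * (nu (x - z) + 8 * G * s).
  move=> s0 /dist_to_lt hx Dz; have [|h1 _] := hP (8 * s); first by lra.
  by have := h1 x z hx Dz; rewrite (mulrCA G) mulrA.
have g_lip s x y : 0 < s -> dist_to x < 8 * s -> dist_to y < 8 * s ->
    nu (x - y) <= 8 * s -> `|g s x - g s y| <= Lf * K * nu (x - y).
  move=> s0 /dist_to_lt hx /dist_to_lt hy xy.
  by have [|_ h2] := hP (8 * s); [lra|exact: h2].
have g_gap s x : 0 < s -> dist_to x < 8 * s ->
    `|g s x - g (2 * s) x| <= Lf * (32 * (1 + G) * s).
  move=> s0 hx; have [z Dz xz] := dist_to_lt hx.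
  have h1 := g_val s x z s0 hx Dz.
  have h2 : `|g (2 * s) x - f z| <= Lf * (nu (x - z) + 8 * G * (2 * s)).
    by apply: g_val => //; lra.
  apply: le_trans (ler_distD (f z) _ _) _; rewrite [X in _ + X]distrC.
  apply: le_trans (lerD h1 h2) _; rewrite -mulrDr ler_wpM2l//.
  by have : 0 <= G * s by [rewrite mulr_ge0// ltW]; lra.
have F_val x z : D z -> `|F x - f z| <= Lf * (nu (x - z) + 16 * G * dist_to x).
  move=> Dz; rewrite /F; case: eqP => [x0|/eqP/r0 xp].
    by rewrite x0 mulr0 addr0; exact: vP.
  have [s0 h1 h2] := scP _ xp; have /andP[t0 t1] := thP x xp.
  have g1 : `|g (sc (dist_to x)) x - f z| <= Lf * (nu (x - z) + 16 * G * dist_to x).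
    apply: le_trans (g_val _ x z s0 _ Dz) _; first by lra.
    rewrite ler_wpM2l// lerD2l -!mulrA [8 * _]mulrCA [16 * _]mulrCA ler_wpM2l//.
    by lra.
  have g2 : `|g (2 * sc (dist_to x)) x - f z| <=
      Lf * (nu (x - z) + 16 * G * dist_to x).
    apply: le_trans (g_val _ x z _ _ Dz) _; [lra|lra|].
    rewrite ler_wpM2l// lerD2l -!mulrA [8 * _]mulrCA [16 * _]mulrCA ler_wpM2l//.
    by lra.
  have := interpolation_dist 0 (thP x xp) g1 g2 (lexx `|f z - f z|).
  by rewrite subr0 scale1r scale0r addr0 subrr normr0 mulr0 addr0.
exists F; split=> [z Dz|].
  have z0 : dist_to z = 0.
    apply/eqP; rewrite eq_le dist_to_ge0 andbT.
    by apply: le_trans (dist_to_le z Dz) _; rewrite subrr seminorm0.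
  apply/eqP; rewrite -subr_eq0 -normr_le0.
  have := F_val z z Dz; rewrite z0 subrr seminorm0//.
  by rewrite mulr0 addr0 mulr0.
move=> x y; wlog xy : x y / dist_to x <= dist_to y.
  move=> hw; have [/hw//|/ltW/hw] := leP (dist_to x) (dist_to y).
  by rewrite distrC sym.
set d := nu (x - y); have d0 : 0 <= d by exact: nu0.
(* If both points are within 4 d of [D], the values are compared through f; the slack e is there
   because the distance to [D] need not be attained. Otherwise the two scales coincide or are
   consecutive. *)
have [far|near_xy] := leP (dist_to y) (4 * d).
  apply/ler_addgt0Pr => e e0.
  have e1 : 0 < e / (2 * Lf + 1) by rewrite divr_gt0//; lra.
  have [|z Dz xz] := @dist_to_lt x (dist_to x + e / (2 * Lf + 1)); first by lra.
  apply: le_trans (ler_distD (f z) _ _) _; rewrite [X in _ + X]distrC.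
  apply: le_trans (lerD (F_val x z Dz) (F_val y z Dz)) _; rewrite -mulrDr.
  have yz : nu (y - z) <= d + nu (x - z) by have := tri x y z; rewrite (sym y x).
  have gx : G * dist_to x <= G * (4 * d) by rewrite ler_wpM2l//; lra.
  have gy : G * dist_to y <= G * (4 * d) by rewrite ler_wpM2l.
  have le1 : nu (x - z) + 16 * G * dist_to x + (nu (y - z) + 16 * G * dist_to y) <=
    (K + 128 * (1 + G)) * d + 2 * (e / (2 * Lf + 1)).
    have : 0 <= K * d by rewrite mulr_ge0.
    by lra.
  apply: le_trans (ler_wpM2l Lf0 le1) _.
  rewrite [leLHS]mulrDr (mulrA Lf _ d) lerD2l.
  have -> : Lf * (2 * (e / (2 * Lf + 1))) = e * (2 * Lf / (2 * Lf + 1)).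
    by field; rewrite gt_eqF//; lra.
  by rewrite ler_piMr ?(ltW e0)// ler_pdivrMr ?mul1r; lra.
have rxy : dist_to y <= dist_to x + d by have := dist_to_lip y x; rewrite sym.
have xp : 0 < dist_to x by lra.
have yp : 0 < dist_to y by lra.
have [s0 sx1 sx2] := scP _ xp; have [_ sy1 sy2] := scP _ yp.
have FE w : 0 < dist_to w -> F w =
    (1 - th w) *: g (sc (dist_to w)) w + th w *: g (2 * sc (dist_to w)) w.
  by move=> wp; rewrite /F gt_eqF.
have thx := thP x xp; have thy := thP y yp.
have -> : Lf * (K + 128 * (1 + G)) * d = Lf * K * d + Lf * (128 * (1 + G) * d) by ring.
have LGd : 0 <= Lf * ((1 + G) * d) by rewrite !mulr_ge0//; lra.
rewrite !FE//; set s := sc (dist_to x) in s0 sx1 sx2 *.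
have [sE|sE] : sc (dist_to y) = s \/ sc (dist_to y) = 2 * s.
- by apply: scS => //; lra.
- rewrite sE in sy1 sy2 *.
  have h1 : `|g s x - g s y| <= Lf * K * d by apply: g_lip; rewrite -?/d; lra.
  have h2 : `|g (2 * s) x - g (2 * s) y| <= Lf * K * d by apply: g_lip; rewrite -?/d; lra.
  have h3 : `|g s y - g (2 * s) y| <= Lf * (32 * (1 + G) * s) by apply: g_gap; lra.
  apply: le_trans (interpolation_dist _ thx h1 h2 h3) _; rewrite lerD2l.
  have -> : th y - th x = (dist_to y - dist_to x) / s.
    by rewrite /th sE -/s; ring.
  rewrite ger0_norm ?divr_ge0 ?subr_ge0 ?(ltW s0)//.
  have -> : (dist_to y - dist_to x) / s * (Lf * (32 * (1 + G) * s)) =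
     Lf * (32 * (1 + G)) * (dist_to y - dist_to x) by field; rewrite gt_eqF.
  have LG : 0 <= Lf * (1 + G) by rewrite mulr_ge0//; lra.
  have : Lf * (1 + G) * (dist_to y - dist_to x) <= Lf * (1 + G) * d.
    by rewrite ler_wpM2l//; lra.
  by lra.
- rewrite sE in sy1 sy2 *.
  have h2 : `|g (2 * s) x - g (2 * s) y| <= Lf * K * d by apply: g_lip; rewrite -?/d; lra.
  have gx : `|g s x - g (2 * s) x| <= Lf * (32 * (1 + G) * s) by apply: g_gap; lra.
  have gy : `|g (2 * s) y - g (2 * (2 * s)) y| <= Lf * (32 * (1 + G) * (2 * s)).
    by apply: g_gap; lra.
  (* At a change of scale both sides are compared with g (2 s). As dist_to x < 2 s <= dist_to y <=
     dist_to x + d, both points are within d of the switching distance 2 s. *)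
  have one : `|(1 - th x) *: g s x + th x *: g (2 * s) x - g (2 * s) x| <=
      Lf * (32 * (1 + G) * d).
    have z0 (w : Z) : `|w - w| <= 0 by rewrite subrr normr0.
    have := interpolation_dist 1 thx (z0 (g s x)) (z0 (g (2 * s) x)) gx.
    rewrite subrr scale0r !add0r scale1r => /le_trans; apply.
    have -> : 1 - th x = (2 * s - dist_to x) / s.
      by rewrite /th -/s; field; rewrite gt_eqF.
    rewrite ger0_norm ?divr_ge0 ?subr_ge0 ?(ltW s0) ?(ltW sx2)//.
    have -> : (2 * s - dist_to x) / s * (Lf * (32 * (1 + G) * s)) =
       32 * (Lf * (1 + G) * (2 * s - dist_to x)) by field; rewrite gt_eqF.
    have -> : Lf * (32 * (1 + G) * d) = 32 * (Lf * (1 + G) * d) by ring.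
    rewrite ler_pM2l// ler_wpM2l ?mulr_ge0//; lra.
  have two : `|(1 - th y) *: g (2 * s) y + th y *: g (2 * (2 * s)) y - g (2 * s) y| <=
      Lf * (32 * (1 + G) * d).
    have z0 (w : Z) : `|w - w| <= 0 by rewrite subrr normr0.
    have := interpolation_dist 0 thy (z0 (g (2 * s) y)) (z0 (g (2 * (2 * s)) y)) gy.
    rewrite subr0 scale1r scale0r !add0r addr0 normrN => /le_trans; apply.
    have -> : th y = (dist_to y - 2 * s) / (2 * s).
      by rewrite /th sE -/s; field; rewrite gt_eqF.
    rewrite ger0_norm ?divr_ge0 ?subr_ge0// ?mulr_ge0 ?(ltW s0)//.
    have -> : (dist_to y - 2 * s) / (2 * s) * (Lf * (32 * (1 + G) * (2 * s))) =
       32 * (Lf * (1 + G) * (dist_to y - 2 * s)) by field; rewrite gt_eqF.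
    have -> : Lf * (32 * (1 + G) * d) = 32 * (Lf * (1 + G) * d) by ring.
    rewrite ler_pM2l// ler_wpM2l ?mulr_ge0//; lra.
  apply: le_trans (ler_distD (g (2 * s) x) _ _) _.
  apply: le_trans (lerD one (ler_distD (g (2 * s) y) _ _)) _.
  rewrite [`|g (2 * s) y - _|]distrC.
  apply: le_trans (lerD (lexx _) (lerD h2 two)) _.
  by lra.
Qed.

End WhitneyInterpolation.

(** * The extension theorem for seminormed spaces with a Mazur-type map *)

Section SeminormedExtension.
Context (R : realType) (V H : lmodType R) (nu : V -> R) (b : H -> H -> R).
Context (nuP : seminorm nu) (bP : psd_form b) (p : R) (M : V -> H).
Local Notation nrm x := (Num.sqrt (b x x)).

Lemma doubling_extension (D : set V) (lam : nat) (Z : completeNormedModType R)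
    (f : V -> Z) (Lf : R) : 2 <= p ->
  (forall u v, nu u <= 1 -> nu v <= 1 ->
    nrm (M u - M v) <= p * nu (u - v)) ->
  (forall u v, nu u <= 1 -> nu v <= 1 -> nrm (M u - M v) <= 10^-1 ->
    nu (v - p^-1 *: u) <= 1 - (24 * p)^-1) ->
  D !=set0 -> (2 <= lam)%N -> snorm_doubling nu D lam -> 0 <= Lf ->
  (forall z z', D z -> D z' -> `|f z - f z'| <= Lf * nu (z - z')) ->
  exists F : V -> Z, (forall z, D z -> F z = f z) /\
    forall x y, `|F x - F y| <=
      (56 * 1000 * 1000 * (p ^+ 2 * Num.sqrt (ln p)) * Num.sqrt (ln lam%:R)) *
        Lf * nu (x - y).
Proof.
move=> p2 M_lip M_shrink D0 lam2 D_dbl Lf0 f_lip.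
have p0 : 0 < p by lra.
have Kc0 := cell_const_ge0 p2 lam.
(* G s is the error E of [local_ext_large], and the 1 in K is the cost of [global_approx_ext]. *)
pose K := 72 * p * cell_const p lam + 1; pose G := 4 * 1000 * p + 1.
have pK0 : 0 <= 72 * p * cell_const p lam by rewrite mulr_ge0//; lra.
have K0 : 0 <= K by rewrite /K; lra.
have G0 : 0 <= G by rewrite /G; lra.
have [s s0|F [Ff FL]] := whitney_extension nuP D0 Lf0 f_lip K0 G0 (f := f).
  have E0 : 0 <= G * s by rewrite mulr_ge0// ltW.
  apply: (global_approx_ext nuP D_dbl Lf0 s0 E0 pK0) => T.
  have -> : G * s = 2 * (2 * 1000 * p * s) + s by rewrite /G; ring.
  exact: (local_ext_large nuP Lf0 f_lip bP p2 M_lip M_shrink lam2 D_dbl).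
exists F; split=> // x y; apply: le_trans (FL x y) _.
rewrite ler_wpM2r ?seminorm_ge0// mulrC ler_wpM2r//.
have ln2 := ln2_ge R.
have lnp : 2^-1 <= ln p by apply: le_trans ln2 _; rewrite ler_ln ?posrE.
have lnlam : 2^-1 <= ln lam%:R :> R.
  by apply: le_trans ln2 _; rewrite ler_ln ?posrE ?ltr0n ?ler_nat// (ltn_trans _ lam2).
pose X := Num.sqrt (ln p) * Num.sqrt (ln lam%:R).
have XE : Num.sqrt (ln p * ln lam%:R) = X by rewrite sqrtrM//; lra.
have X1 : 2^-1 <= X.
  rewrite -XE -[2^-1]ger0_norm -?sqrtr_sqr; last by lra.
  rewrite ler_wsqrtr// expr2; apply: ler_pM => //; lra.
have -> : 56 * 1000 * 1000 * (p ^+ 2 * Num.sqrt (ln p)) * Num.sqrt (ln lam%:R) =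
  56 * 1000 * 1000 * (p ^+ 2 * X) by rewrite /X; ring.
have -> : K + 128 * (1 + G) = 72 * 768 * 1000 * (p ^+ 2 * X) + 512 * 1000 * p + 257.
  by rewrite /K /G /cell_const XE; ring.
(* Absorbs the lower-order terms: 72 * 768 * 1000 + 512 * 1000 + 257 / 2 is below 56 * 10^6. *)
have p2X : p <= p ^+ 2 * X.
  rewrite expr2 -mulrA; apply: ler_peMr; first exact: ltW.
  have : 2 * 2^-1 <= p * X by apply: ler_pM => //; lra.
  by rewrite divff.
clearbody X; move: (p ^+ 2 * X) p2X => Y p2Y.
lra.
Qed.

End SeminormedExtension.

(** * The Mazur map *)

Section MazurPointwise.
Context (R : realType) (p : R) (p2 : 2 <= p).
Implicit Types a b m q s t u v x y z : R.

Definition mazur (a : R) : R := Num.sg a * `|a| `^ (p / 2).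

Let p0 : 0 < p := lt_le_trans (ltr0Sn _ 1) p2.
Let q1 : 1 <= p / 2. Proof. by rewrite ler_pdivlMr// mul1r. Qed.
Let q0 : 0 < p / 2 := lt_le_trans ltr01 q1.

Lemma mazurN a : mazur (- a) = - mazur a.
Proof. by rewrite /mazur sgrN normrN mulNr. Qed.

Lemma mazur_ge0E a : 0 <= a -> mazur a = a `^ (p / 2).
Proof.
rewrite /mazur le_eqVlt => /predU1P[<-|a0].
  by rewrite sgr0 mul0r powR0// gt_eqF.
by rewrite gtr0_sg// mul1r gtr0_norm.
Qed.

Lemma sqr_powR_half a : (a `^ (p / 2)) ^+ 2 = a `^ p.
Proof. by rewrite -powR_mulrn ?powR_ge0// -powRrM divfK// pnatr_eq0. Qed.

Lemma mazur_sqr a : mazur a ^+ 2 = `|a| `^ p.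
Proof.
have [a0|a0] := leP 0 a.
  by rewrite mazur_ge0E// ger0_norm// sqr_powR_half.
by rewrite -[a]opprK mazurN sqrrN normrN mazur_ge0E ?oppr_ge0 1?ltW//
  gtr0_norm ?oppr_gt0// sqr_powR_half.
Qed.

(** Young's inequality with second factor 1. *)
Lemma powR_bernoulli s q : 0 <= s -> 1 <= q -> 1 - s `^ q <= q * (1 - s).
Proof.
move=> s0; rewrite le_eqVlt => /predU1P[<-|q_gt1].
  by rewrite powRr1// mul1r.
have q_gt0 : 0 < q by lra.
have r0 : 0 < q / (q - 1) by rewrite divr_gt0//; lra.
have conj : q^-1 + (q / (q - 1))^-1 = 1.
  by field; apply/andP; split; rewrite gt_eqF//; lra.
have := conjugate_powR s0 ler01 q_gt0 r0 conj.
rewrite powR1 mulr1 div1r.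
have -> : (q / (q - 1))^-1 = 1 - q^-1.
  by apply/eqP; rewrite eq_sym subr_eq addrC conj.
rewrite -(ler_pM2l q_gt0).
have -> : q * (s `^ q / q + (1 - q^-1)) = s `^ q + q - 1 by field; rewrite gt_eqF.
lra.
Qed.

Lemma mazur_lip_unit a b : `|a| <= 1 -> `|b| <= 1 ->
  `|mazur a - mazur b| <= p / 2 * `|a - b|.
Proof.
wlog ab : a b / `|b| <= `|a|.
  move=> hw a1 b1; have [h|/ltW h] := leP `|b| `|a|; first exact: hw.
  by rewrite distrC [X in _ * X]distrC; exact: hw.
wlog a0 : a b ab / 0 <= a.
  move=> hw a1 b1; have [h|/ltW h] := leP 0 a; first exact: hw.
  have := hw (- a) (- b); rewrite !normrN oppr_ge0 => /(_ ab h a1 b1).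
  by rewrite !mazurN -!opprD !normrN.
rewrite (ger0_norm a0) in ab *; move=> a1 b1.
have [az|an] := eqVneq a 0.
  move: ab; rewrite az normr_le0 => /eqP ->.
  by rewrite !subrr normr0 mulr0.
have ap : 0 < a by rewrite lt_neqAle eq_sym an.
have aq : a `^ (p / 2) <= a by rewrite ge1r_powR// ap.
rewrite (mazur_ge0E a0); have [b0|b0] := leP 0 b.
  rewrite (ger0_norm b0) in ab b1.
  rewrite mazur_ge0E// !ger0_norm ?subr_ge0//; last by rewrite ge0_ler_powR// ltW.
  have bE : b = a * (b / a) by field.
  rewrite bE powRM ?divr_ge0//.
  have s0 : 0 <= b / a by rewrite divr_ge0.
  have s1 : b / a <= 1 by rewrite ler_pdivrMr// mul1r.
  have h := powR_bernoulli s0 q1.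
  apply: (@le_trans _ _ (a `^ (p / 2) * (p / 2 * (1 - b / a)))).
    have := ler_wpM2l (powR_ge0 a (p / 2)) h.
    by rewrite mulrBr mulr1.
  have -> : p / 2 * (a - a * (b / a)) = a * (p / 2 * (1 - b / a)) by ring.
  by rewrite ler_wpM2r// mulr_ge0 ?subr_ge0// ltW.
rewrite (ltr0_norm b0) in ab b1.
have b0' : 0 < - b by rewrite oppr_gt0.
have bq : (- b) `^ (p / 2) <= - b by rewrite ge1r_powR// b0'.
rewrite -[b]opprK mazurN (mazur_ge0E (ltW b0')) !opprK.
have qa := powR_ge0 a (p / 2); have qb := powR_ge0 (- b) (p / 2).
rewrite !ger0_norm ?addr_ge0 ?(ltW b0')//.
apply: (@le_trans _ _ (1 * (a - b))); first by lra.
by rewrite ler_wpM2r//; lra.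
Qed.

Lemma mazurM m a : 0 <= m -> mazur (m * a) = m `^ (p / 2) * mazur a.
Proof.
rewrite le_eqVlt => /predU1P[<-|m0].
  by rewrite mul0r /mazur sgr0 mul0r powR0 ?mul0r// gt_eqF.
by rewrite /mazur sgrM gtr0_sg// mul1r normrM powRM// (gtr0_norm m0) mulrCA.
Qed.

(** A pointwise substitute for Hölder's inequality. With m the larger modulus and w = |a - b|,
    homogeneity gives the bound (p/2)^2 m^(p-2) w^2, and m^(p-2) w^2 is at most t^2 m^p or t^2
    (w/t)^p according as w <= t m or not. *)
Lemma mazur_dist_sqr_le a b t : 0 < t ->
  (mazur a - mazur b) ^+ 2 <=
  (p / 2) ^+ 2 * t ^+ 2 *
    (`|a| `^ p + `|b| `^ p + (`|a - b| / t) `^ p).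
Proof.
move=> t0; wlog ab : a b / `|b| <= `|a|.
  move=> hw; have [/hw//|/ltW/hw] := leP `|b| `|a|.
  by rewrite -sqrrN opprB distrC [`|b| `^ _ + _]addrC.
have [az|an] := eqVneq a 0.
  move: ab; rewrite az normr0 normr_le0 => /eqP ->.
  rewrite subrr expr0n /=; apply: mulr_ge0.
    by apply: mulr_ge0; exact: sqr_ge0.
  by rewrite !addr_ge0 ?powR_ge0.
set m := `|a| in ab *; have m0 : 0 < m by rewrite normr_gt0.
have aE : a = m * (a / m) by field; rewrite gt_eqF.
have bE : b = m * (b / m) by field; rewrite gt_eqF.
have am1 : `|a / m| <= 1 by rewrite normrM normfV normr_id divff// gt_eqF.
have bm1 : `|b / m| <= 1.
  by rewrite normrM normfV (gtr0_norm m0) ler_pdivrMr// mul1r.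
have lip := mazur_lip_unit am1 bm1.
set w := `|a - b|; have w0 : 0 <= w := normr_ge0 _.
have abm : `|a / m - b / m| = w / m.
  by rewrite -mulrBl normrM normfV (gtr0_norm m0).
have -> : (mazur a - mazur b) ^+ 2 =
    m `^ p * (mazur (a / m) - mazur (b / m)) ^+ 2.
  have eA : mazur a = m `^ (p / 2) * mazur (a / m) by rewrite -mazurM ?(ltW m0)// -aE.
  have eB : mazur b = m `^ (p / 2) * mazur (b / m) by rewrite -mazurM ?(ltW m0)// -bE.
  by rewrite [in LHS]eA [in LHS]eB -mulrBr exprMn sqr_powR_half.
have lip2 : (mazur (a / m) - mazur (b / m)) ^+ 2 <= (p / 2 * (w / m)) ^+ 2.
  rewrite -abm -[leLHS]real_normK ?num_real// lerXn2r ?nnegrE ?normr_ge0//.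
  by rewrite mulr_ge0// ltW.
apply: le_trans (ler_wpM2l (powR_ge0 m p) lip2) _.
rewrite exprMn mulrCA -mulrA ler_wpM2l ?sqr_ge0//.
have P1 := powR_ge0 m p; have P2 := powR_ge0 `|b| p.
have P3 := powR_ge0 (w / t) p; have T2 := sqr_ge0 t.
have [wtm|mwt] := leP w (t * m).
  have : (w / m) ^+ 2 <= t ^+ 2.
    by rewrite lerXn2r ?nnegrE ?divr_ge0 ?(ltW t0) ?(ltW m0)// ler_pdivrMr.
  move=> /(ler_wpM2l P1)/le_trans; apply; rewrite mulrC ler_wpM2l//.
  by rewrite -addrA lerDl addr_ge0.
have wt : m < w / t by rewrite ltr_pdivlMr// mulrC.
have r1 : 1 <= w / t / m by rewrite ler_pdivlMr// mul1r ltW.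
have -> : (w / m) ^+ 2 = t ^+ 2 * (w / t / m) ^+ 2.
  by field; rewrite !gt_eqF.
rewrite mulrCA ler_wpM2l//.
apply: le_trans (_ : (w / t) `^ p <= _); last by rewrite lerDr addr_ge0.
have {2}-> : w / t = m * (w / t / m) by field; rewrite !gt_eqF.
rewrite powRM ?(ltW m0) ?(le_trans ler01 r1)// ler_wpM2l//.
by rewrite -powR_mulrn ?(le_trans ler01 r1)// ler_powR.
Qed.

Lemma powR_le_expR x : -1 < x -> (1 + x) `^ p <= expR (x * p).
Proof.
move=> x1; rewrite /powR gt_eqF; last by lra.
rewrite ler_expR mulrC ler_wpM2r ?(ltW p0)//.
exact: le_ln1Dx.
Qed.

Lemma le_max_powR x y z : 0 <= x -> 0 <= y -> z <= Num.max x y -> 0 <= z ->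
  z `^ p <= x `^ p + y `^ p.
Proof.
move=> x0 y0 zxy z0; have [X Y] := (powR_ge0 x p, powR_ge0 y p).
move: zxy; rewrite le_max => /orP[zx|zy].
  by rewrite ler_wpDr// ge0_ler_powR// ltW.
by rewrite ler_wpDl// ge0_ler_powR// ltW.
Qed.

(* If mazur u and mazur v are close and v is not small compared to u, then u
   has the sign of v and is comparable to it, so subtracting u / p shrinks v
   by a factor 1 - c / p, which becomes a constant after raising to the
   power p. *)
Lemma mazur_shrink_pointwise u v :
  `|v - p^-1 * u| `^ p <=
    2 / 3 * `|v| `^ p + 4^-1 * `|u| `^ p + 4 * (mazur u - mazur v) ^+ 2.
Proof.
wlog v0 : u v / 0 <= v.
  move=> hw; have [/hw//|v0] := leP 0 v.
  have := hw (- u) (- v); rewrite oppr_ge0 => /(_ (ltW v0)).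
  by rewrite !mazurN !normrN mulrN -!opprD !normrN sqrrN.
have p_ge2 := p2; have ip0 : 0 < p^-1 by rewrite invr_gt0.
have ip1 : p^-1 <= 2^-1 by rewrite lef_pV2 ?posrE.
have U0 := powR_ge0 `|u| p; have V0 := powR_ge0 v p.
have Q0 := sqr_ge0 (mazur u - mazur v).
rewrite (ger0_norm v0).
(* If u >= v / 2, then |v - u / p| is at most (1 - 1/(2p)) v or u / p, whose p-th powers are at most
   exp (-1/2) v^p <= 2/3 v^p and u^p / 4. *)
have [u_ge|u_lt] := leP (v / 2) u.
  have u0 : 0 <= u by lra.
  rewrite (ger0_norm u0) in U0 *.
  have iu : 0 <= p^-1 * u by rewrite mulr_ge0// ltW.
  have iv : p^-1 * (v / 2) <= p^-1 * u by rewrite ler_wpM2l// ltW.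
  have c0 : 0 <= 1 + - (2 * p)^-1.
    by rewrite invfM; lra.
  have h : `|v - p^-1 * u| <= Num.max ((1 + - (2 * p)^-1) * v) (p^-1 * u).
    rewrite le_max !ler_norml; have [le|lt] := leP (p^-1 * u) v.
      apply/orP; left; rewrite invfM; apply/andP; split; last by lra.
      have : p^-1 * v <= 2^-1 * v by rewrite ler_wpM2r.
      by lra.
    by apply/orP; right; apply/andP; split; lra.
  apply: le_trans (le_max_powR _ _ h (normr_ge0 _)) _; [by rewrite mulr_ge0|by []|].
  rewrite !powRM// ?(ltW ip0)//.
  have h1 : (1 + - (2 * p)^-1) `^ p <= 2 / 3.
    apply: le_trans (powR_le_expR _) _; first by rewrite invfM; lra.
    have -> : - (2 * p)^-1 * p = - 2^-1 by field; rewrite gt_eqF.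
    rewrite expRN -[2 / 3]invrK lef_pV2 ?posrE ?expR_gt0 ?invr_gt0 ?divr_gt0//.
    by apply: le_trans (expR_ge1Dx _); lra.
  have h2 : p^-1 `^ p <= 4^-1.
    apply: (@le_trans _ _ (2^-1 `^ p)); first by rewrite ge0_ler_powR ?nnegrE// ltW.
    apply: (@le_trans _ _ (2^-1 `^ 2)); last by rewrite powR_mulrn//; lra.
    by apply: ger_powR => //; apply/andP; split; lra.
  have := ler_wpM2r V0 h1; have := ler_wpM2r U0 h2.
  by lra.
(* For 0 <= u < v / 2 the Mazur images differ by at least half of v^(p/2), so their squared
   difference pays for all of v^p. *)
have [u0|u0] := leP 0 u.
  have iu : 0 <= p^-1 * u by rewrite mulr_ge0// ltW.
  have iv : p^-1 * u <= 2^-1 * u by rewrite ler_wpM2r.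
  have h : `|v - p^-1 * u| `^ p <= v `^ p.
    rewrite ge0_ler_powR ?nnegrE ?normr_ge0 ?(ltW p0)//.
    by rewrite ger0_norm; lra.
  have uv : u `^ (p / 2) <= 2^-1 * v `^ (p / 2).
    apply: (@le_trans _ _ ((2^-1 * v) `^ (p / 2))).
      by rewrite ge0_ler_powR ?nnegrE ?mulr_ge0 ?(ltW q0)//; lra.
    rewrite powRM// ler_wpM2r ?powR_ge0//.
    by rewrite ge1r_powR//; apply/andP; split; lra.
  have : v `^ p <= 4 * (mazur u - mazur v) ^+ 2.
    rewrite !mazur_ge0E// -sqr_powR_half.
    have vq := powR_ge0 v (p / 2); have uq := powR_ge0 u (p / 2).
    have -> : 4 * (u `^ (p / 2) - v `^ (p / 2)) ^+ 2 =
      (2 * (v `^ (p / 2) - u `^ (p / 2))) ^+ 2 by ring.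
    by rewrite lerXn2r ?nnegrE//; lra.
  by lra.
have u0' : 0 < - u by lra.
(* For opposite signs the moduli of the Mazur images add up, and (1 + 1/p)^p <= e <= 4. *)
set m := Num.max v (- u).
have m0 : 0 <= m by rewrite le_max v0.
have h : `|v - p^-1 * u| `^ p <= 4 * m `^ p.
  apply: (@le_trans _ _ (((1 + p^-1) * m) `^ p)).
    rewrite ge0_ler_powR ?nnegrE ?normr_ge0 ?mulr_ge0 ?(ltW p0)//; first by lra.
    have pu : 0 <= p^-1 * - u by rewrite mulr_ge0 ?ltW.
    have um : p^-1 * - u <= p^-1 * m.
      by rewrite ler_wpM2l ?(ltW ip0)// le_max lexx orbT.
    have vm : v <= m by rewrite le_max lexx.
    by rewrite ger0_norm; lra.
  rewrite powRM//; last by lra.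
  rewrite ler_wpM2r ?powR_ge0//.
  apply: le_trans (powR_le_expR _) _; first by lra.
  rewrite mulVf ?gt_eqF//.
  have -> : 1 = 2^-1 + 2^-1 :> R by field.
  have e2 : expR 2^-1 <= 2 :> R.
    rewrite -[2^-1]opprK expRN invf_ple ?posrE ?expR_gt0//.
    by apply: le_trans (expR_ge1Dx _); lra.
  rewrite expRD; have := ler_pM (expR_ge0 _) (expR_ge0 _) e2 e2; lra.
have : m `^ p <= (mazur u - mazur v) ^+ 2.
  have uE : mazur u = - (- u) `^ (p / 2).
    by rewrite -[u in LHS]opprK mazurN mazur_ge0E// ltW.
  rewrite uE mazur_ge0E// -[leLHS]sqr_powR_half.
  have vq := powR_ge0 v (p / 2); have uq := powR_ge0 (- u) (p / 2).
  have mq : m `^ (p / 2) <= v `^ (p / 2) + (- u) `^ (p / 2).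
    by rewrite /m; case: (leP v (- u)) => _; lra.
  have -> : (- (- u) `^ (p / 2) - v `^ (p / 2)) ^+ 2 =
    (v `^ (p / 2) + (- u) `^ (p / 2)) ^+ 2 by ring.
  by rewrite lerXn2r ?nnegrE ?powR_ge0 ?addr_ge0.
by lra.
Qed.

End MazurPointwise.

(** * Lebesgue spaces *)

Section MazurMap.
Context d (T : measurableType d) (R : realType) (mu : {measure set T -> \bar R}).
Context (p : R) (p2 : 2 <= p) (p1 : (1 <= p%:E)%E) (h2 : (1 <= (2 : R)%:E)%E).
Local Notation V := (LfunType mu p1).
Local Notation H := (LfunType mu h2).

Let p0 : 0 < p := lt_le_trans (ltr0Sn _ 1) p2.
Let p_ge1 : 1 <= p. Proof. by apply: le_trans p2; rewrite ler1n. Qed.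

Let pow1 : 1 `^ p = 1 :> R. Proof. by rewrite powR1. Qed.

Definition Lfun_norm (u : V) : R := fine 'N[mu]_(p%:E)[EFin \o (u : T -> R)].

Definition L2_inner (f g : H) : R := \int[mu]_x (f x * g x).

Lemma Lfun_norm_seminorm : seminorm Lfun_norm.
Proof.
split=> [f g|a f]; first exact: ler_LnormD.
apply: EFin_inj; rewrite /Lfun_norm EFinM !finite_norm_fine.
exact: LnormZ.
Qed.

Lemma integrable_EFinD (f g : T -> R) : mu.-integrable setT (EFin \o f) ->
  mu.-integrable setT (EFin \o g) ->
  mu.-integrable setT (EFin \o (fun x => f x + g x)).
Proof. by move=> fi gi; exact: (integrableD measurableT fi gi). Qed.

Lemma integrable_EFinZ (c : R) (f : T -> R) : mu.-integrable setT (EFin \o f) ->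
  mu.-integrable setT (EFin \o (fun x => c * f x)).
Proof. by move=> fi; exact: (integrableZl measurableT c fi). Qed.

Lemma integrable_powR (u : V) : mu.-integrable setT (EFin \o (fun x => `|u x| `^ p)).
Proof. exact: Lfun_integrable p_ge1 (LfunP u). Qed.

Lemma Lfun_norm_powR (u : V) : Lfun_norm u `^ p = \int[mu]_x `|u x| `^ p.
Proof.
apply: EFin_inj; rewrite /Rintegral fineK; last first.
  by apply: integrable_fin_num => //; exact: integrable_powR.
rewrite -poweR_EFin finite_norm_fine powR_Lnorm ?gt_eqF//.
Qed.

Lemma integrable_mul (f g : H) : mu.-integrable setT (EFin \o (fun x => f x * g x)).
Proof. by apply/Lfun1_integrable; apply: Lfun2_mul_Lfun1; exact: LfunP. Qed.

Lemma L2_inner_psd : psd_form L2_inner.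
Proof.
split.
- move=> f g h; rewrite /L2_inner -RintegralD//; try exact: integrable_mul.
  by apply: eq_Rintegral => x _; rewrite -mulrDl.
- move=> a f g; rewrite /L2_inner -RintegralZl//; last exact: integrable_mul.
  by apply: eq_Rintegral => x _; rewrite mulrA.
- by move=> f g; apply: eq_Rintegral => x _; rewrite mulrC.
- by move=> f; apply: Rintegral_ge0 => x _; rewrite -expr2 sqr_ge0.
Qed.

Lemma measurable_mazur : measurable_fun [set: R] (@mazur R p).
Proof.
have -> : @mazur R p = fun a => Num.max a 0 `^ (p / 2) - Num.max (- a) 0 `^ (p / 2).
  apply/funext => a; have q0 : p / 2 != 0 by rewrite gt_eqF// divr_gt0.
  have [a0|a0] := leP 0 a.
    by rewrite mazur_ge0E// max_r ?oppr_le0// powR0// subr0.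
  have Na0 : 0 <= - a by rewrite oppr_ge0 ltW.
  rewrite (max_l Na0) powR0// sub0r.
  by rewrite -(mazur_ge0E p2 Na0) mazurN opprK.
apply: measurable_funB; apply: (measurableT_comp (measurable_powR _)).
  exact: measurable_maxr.
by apply: measurable_maxr => //; exact: measurable_oppr.
Qed.

Lemma mazur_Lfun (u : V) : (@mazur R p \o u) \in Lfun mu (2 : R)%:E.
Proof.
apply/andP; split; rewrite inE.
  by apply: measurableT_comp; [exact: measurable_mazur|].
rewrite /= /finite_norm unlock /=; apply: poweR_lty.
have -> : (\int[mu]_x `|(EFin \o (mazur p \o u)) x| `^ 2 =
    \int[mu]_x (`|u x| `^ p)%:E)%E.
  apply: eq_integral => x _ /=.
  by rewrite -[2]/(2%:R) powR_mulrn// real_normK ?num_real// mazur_sqr.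
exact: integrable_lty (integrable_powR u).
Qed.

Definition mazur_map (u : V) : H := Lfun_Sub h2 (mazur_Lfun u).

Lemma mazur_map_dist (u v : V) :
  L2_inner (mazur_map u - mazur_map v) (mazur_map u - mazur_map v) =
  \int[mu]_x (mazur p (u x) - mazur p (v x)) ^+ 2.
Proof. by apply: eq_Rintegral => x _; rewrite expr2. Qed.

Lemma integrable_mazur_dist (u v : V) :
  mu.-integrable setT (EFin \o (fun x => (mazur p (u x) - mazur p (v x)) ^+ 2)).
Proof.
have := integrable_mul (mazur_map u - mazur_map v) (mazur_map u - mazur_map v).
by apply: eq_integrable => // x _ /=; rewrite expr2.
Qed.

Lemma Lfun_norm_ge0 (u : V) : 0 <= Lfun_norm u.
Proof. exact: seminorm_ge0 Lfun_norm_seminorm. Qed.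

Lemma Rintegral_powR_le1 (u : V) : Lfun_norm u <= 1 -> \int[mu]_x `|u x| `^ p <= 1.
Proof.
move=> u1; rewrite -Lfun_norm_powR -[leRHS]pow1.
by rewrite ge0_ler_powR ?nnegrE ?Lfun_norm_ge0 ?(ltW p0).
Qed.

Lemma mazur_map_lip (u v : V) : Lfun_norm u <= 1 -> Lfun_norm v <= 1 ->
  Num.sqrt (L2_inner (mazur_map u - mazur_map v) (mazur_map u - mazur_map v)) <=
    p * Lfun_norm (u - v).
Proof.
move=> u1 v1; have p_ge2 := p2.
apply/ler_addgt0Pr => e e0.
(* The slack keeps t positive when u = v almost everywhere. The three integrals are at most 1 each,
   and 3 (p/2)^2 t^2 <= (p t)^2. *)
pose t := Lfun_norm (u - v) + e / p.
have ep : 0 < e / p by rewrite divr_gt0.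
have t0 : 0 < t by rewrite ltr_wpDl// Lfun_norm_ge0.
have uvt : Lfun_norm (u - v) <= t by rewrite lerDl ltW.
have -> : p * Lfun_norm (u - v) + e = p * t.
  by rewrite /t; field; rewrite gt_eqF.
have pt0 : 0 <= p * t by rewrite mulr_ge0 ?ltW.
rewrite -[leRHS](ger0_norm pt0) -sqrtr_sqr ler_wsqrtr// mazur_map_dist.
pose c := (p / 2) ^+ 2 * t ^+ 2.
have iu := integrable_powR u; have iv := integrable_powR v.
have iuv := integrable_powR (u - v).
have isum : mu.-integrable setT
    (EFin \o (fun x => `|u x| `^ p + `|v x| `^ p)) by exact: integrable_EFinD.
have iuvt : mu.-integrable setT
    (EFin \o (fun x => t^-1 `^ p * `|u x - v x| `^ p)).
  exact: integrable_EFinZ iuv.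
have itot : mu.-integrable setT (EFin \o
    (fun x => `|u x| `^ p + `|v x| `^ p + t^-1 `^ p * `|u x - v x| `^ p)).
  exact: integrable_EFinD.
apply: (@le_trans _ _ (\int[mu]_x (c * (`|u x| `^ p + `|v x| `^ p +
    t^-1 `^ p * `|u x - v x| `^ p)))).
  apply: le_Rintegral => //; first exact: integrable_mazur_dist.
    exact: integrable_EFinZ.
  move=> x _; have := mazur_dist_sqr_le p2 (u x) (v x) t0.
  by rewrite [`|u x - v x| / t]mulrC powRM ?invr_ge0 ?(ltW t0).
rewrite RintegralZl// RintegralD// RintegralD// RintegralZl//.
have I1 := Rintegral_powR_le1 u1; have I2 := Rintegral_powR_le1 v1.
have I3 : t^-1 `^ p * \int[mu]_x `|u x - v x| `^ p <= 1.
  rewrite -[X in _ * X]/(\int[mu]_x `|(u - v) x| `^ p) -Lfun_norm_powR.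
  rewrite -powRM ?invr_ge0 ?(ltW t0) ?Lfun_norm_ge0// -[leRHS]pow1.
  rewrite ge0_ler_powR ?nnegrE ?mulr_ge0 ?invr_ge0 ?Lfun_norm_ge0 ?(ltW p0) ?(ltW t0)//.
  by rewrite mulrC ler_pdivrMr// mul1r.
have c0 : 0 <= c by rewrite mulr_ge0 ?sqr_ge0.
have -> : (p * t) ^+ 2 = c * 4 by rewrite /c; field.
apply: (ler_wpM2l c0); move: I1 I2 I3.
by move: (Rintegral _ _ _) (Rintegral _ _ _) (_ * Rintegral _ _ _) => *; lra.
Qed.

(** Integrating the pointwise bound gives 2/3 + 1/4 + 4/100 <= 23/24, and Bernoulli's inequality
    gives (1 - 1/(24 p))^p >= 23/24. *)
Lemma mazur_map_shrink (u v : V) : Lfun_norm u <= 1 -> Lfun_norm v <= 1 ->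
  Num.sqrt (L2_inner (mazur_map u - mazur_map v) (mazur_map u - mazur_map v)) <=
    10^-1 ->
  Lfun_norm (v - p^-1 *: u) <= 1 - (24 * p)^-1.
Proof.
move=> u1 v1 uv; have p_ge2 := p2.
have iu := integrable_powR u; have iv := integrable_powR v.
have im := integrable_mazur_dist u v.
have iw := integrable_powR (v - p^-1 *: u).
have i1 : mu.-integrable setT (EFin \o (fun x => 2 / 3 * `|v x| `^ p)).
  exact: integrable_EFinZ.
have i2 : mu.-integrable setT (EFin \o (fun x => 4^-1 * `|u x| `^ p)).
  exact: integrable_EFinZ.
have i3 : mu.-integrable setT
    (EFin \o (fun x => 4 * (mazur p (u x) - mazur p (v x)) ^+ 2)).
  exact: integrable_EFinZ.
have i12 : mu.-integrable setT
    (EFin \o (fun x => 2 / 3 * `|v x| `^ p + 4^-1 * `|u x| `^ p)).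
  exact: integrable_EFinD.
have h : Lfun_norm (v - p^-1 *: u) `^ p <= 23 / 24.
  rewrite Lfun_norm_powR.
  apply: (@le_trans _ _ (\int[mu]_x (2 / 3 * `|v x| `^ p + 4^-1 * `|u x| `^ p +
      4 * (mazur p (u x) - mazur p (v x)) ^+ 2))).
    apply: le_Rintegral => //; first exact: integrable_EFinD.
    by move=> x _; exact: mazur_shrink_pointwise.
  rewrite RintegralD// RintegralD// !RintegralZl// -mazur_map_dist.
  have I1 := Rintegral_powR_le1 u1; have I2 := Rintegral_powR_le1 v1.
  have b0 : 0 <= L2_inner (mazur_map u - mazur_map v) (mazur_map u - mazur_map v).
    by case: L2_inner_psd.
  have : L2_inner (mazur_map u - mazur_map v) (mazur_map u - mazur_map v) <= 100^-1.
    rewrite -[leLHS]sqr_sqrtr//.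
    have -> : 100^-1 = 10^-1 ^+ 2 :> R by field.
    by rewrite lerXn2r ?nnegrE ?sqrtr_ge0//; lra.
  clear -I1 I2; move: I1 I2; move: (Rintegral _ _ _) (Rintegral _ _ _) (L2_inner _ _).
  by move=> x y z; lra.
set c := 1 - _; have ip : (24 * p)^-1 <= 48^-1 by rewrite lef_pV2 ?posrE; lra.
have c0 : 0 <= c by rewrite /c; lra.
rewrite leNgt; apply/negP => cw.
have : c `^ p < Lfun_norm (v - p^-1 *: u) `^ p.
  by rewrite gt0_ltr_powR ?nnegrE ?Lfun_norm_ge0.
have := powR_bernoulli c0 p_ge1.
have -> : p * (1 - c) = 24^-1 by rewrite /c; field; rewrite gt_eqF.
by lra.
Qed.

End MazurMap.

(** * From functions to classes modulo equality almost everywhere *)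

Section LspaceRepresentatives.
Context d (T : measurableType d) (R : realType) (mu : {measure set T -> \bar R}).
Context (p : R) (p1 : (1 <= p%:E)%E).

Lemma Lspace_mem_Lfun (f : LspaceType mu p1) : (f : T -> R) \in Lfun mu p%:E.
Proof.
apply/andP; split; rewrite inE; last exact: Lebesgue_finite.
pose fc : aeEqMfun (T1 := T) (measurableTypeR R) mu := f.
exact: (@measurable_funPT _ _ _ _ (repr fc)).
Qed.

Definition Lspace_repr (f : LspaceType mu p1) : LfunType mu p1 :=
  Lfun_Sub p1 (Lspace_mem_Lfun f).

Lemma Lspace_mdistE (f g : LspaceType mu p1) :
  mdist f g = Lfun_norm (Lspace_repr f - Lspace_repr g).
Proof. by []. Qed.

End LspaceRepresentatives.

Lemma Lip_le (R : realType) (X Y : metricType R) (F : X -> Y) (L : R) : 0 <= L ->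
  (forall x y, mdist (F x) (F y) <= L * mdist x y) -> (Lip F <= L%:E)%E.
Proof. by move=> L0 FL; apply: ereal_inf_lbound; exists L. Qed.

Lemma Lip_ge0 (R : realType) (X Y : metricType R) (F : X -> Y) : (0 <= Lip F)%E.
Proof. by apply: le_ereal_inf_tmp => _ [L [L0 _] <-]; rewrite lee_fin. Qed.

(** The infimum in [Lip] is attained; the 1 added to the distance avoids division by 0. *)
Lemma Lip_bound (R : realType) (X Y : metricType R) (F : X -> Y) (L : R) :
  Lip F = L%:E -> forall x y, mdist (F x) (F y) <= L * mdist x y.
Proof.
move=> FL x y; apply/ler_addgt0Pr => e e0.
have dp : 0 < mdist x y + 1 by rewrite ltr_wpDl// mdist_ge0.
have : (Lip F < (L + e / (mdist x y + 1))%:E)%E.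
  by rewrite FL lte_fin ltrDl divr_gt0.
move=> /ereal_inf_lt[_ [L' [L'0 hL'] <-]]; rewrite lte_fin => L'L.
apply: le_trans (hL' x y) _.
apply: (@le_trans _ _ ((L + e / (mdist x y + 1)) * mdist x y)).
  by rewrite ler_wpM2r ?mdist_ge0// ltW.
rewrite mulrDl lerD2l mulrAC -mulrA ler_piMr ?(ltW e0)//.
by rewrite ler_pdivrMr// mul1r lerDl.
Qed.

Theorem theorem1p9 (R : realType) :
  exists C : R, 0 < C /\
    forall (p : R) (p2 : 2 <= p) (lam : nat) (D : set (Lp01 (Lp01_exponent p2)))
           (Z : completeNormedModType R),
      (2 <= lam)%N ->
      (exists x y, [/\ D x, D y & x <> y]) ->
      doubling lam (set_type D) ->
      (ext_modulus D (normmetric Z)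
        <= (C * (p ^+ 2 * Num.sqrt (ln p)) * Num.sqrt (ln lam%:R))%:E)%E.
Proof.
exists (56 * 1000 * 1000); split; first by lra.
move=> p p2 lam D Z lam2 [x0 [_ [Dx0 _ _]]] dbl.
set p1 := Lp01_exponent p2 in D x0 Dx0 dbl *.
have h2 : (1 <= (2 : R)%:E)%E by rewrite lee_fin ler1n.
pose rep (x : Lp01 p1) : LfunType (lebesgue01 R) p1 := Lspace_repr x.
have rep_inj x y : rep x = rep y -> x = y.
  move=> xy; apply: mdist_positivity; rewrite Lspace_mdistE -/(rep x) -/(rep y) xy subrr.
  exact: seminorm0 (Lfun_norm_seminorm _ _).
pose D' : set (LfunType (lebesgue01 R) p1) := rep @` D.
have D'0 : D' !=set0 by exists (rep x0), x0.
have dbl' : snorm_doubling (@Lfun_norm _ _ _ (lebesgue01 R) p p1) D' lam.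
  move=> r _ r0 [x Dx <-].
  have [y hy] := dbl r (exist _ x (mem_set Dx)) r0.
  exists (fun i => rep (val (y i))); split=> [i|_ [v Dv <-] xv].
    by exists (val (y i)) => //; exact: set_valP.
  have [|i _ yv] := hy (exist _ v (mem_set Dv)).
    by rewrite /mcball /=.
  by exists i.
set Cst := 56 * 1000 * 1000 * _ * _.
have Cst0 : 0 < Cst.
  have lnp : 0 < ln p by rewrite ln_gt0//; lra.
  have lnlam : 0 < ln lam%:R :> R by rewrite ln_gt0// ltr1n.
  have S0 : 0 < p ^+ 2 * Num.sqrt (ln p).
    by rewrite mulr_gt0 ?sqrtr_gt0// exprn_gt0//; lra.
  have L0 : 0 < Num.sqrt (ln lam%:R : R) by rewrite sqrtr_gt0.
  by apply: mulr_gt0 L0; lra.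
apply: ereal_inf_lbound; exists Cst => //; split=> // f.
(* f transported to functions, with the default value 0 off the chosen representatives of [D];
   [rep_inj] makes this consistent. *)
have /choice[F0 F0f] : forall v : LfunType (lebesgue01 R) p1, exists y : Z,
    forall c : set_type D, rep (val c) = v -> y = f c.
  move=> v; have [[c cv]|nc] := pselect (exists c : set_type D, rep (val c) = v).
    by exists (f c) => c'; rewrite -cv => /rep_inj/val_inj ->.
  by exists 0 => c cv; exfalso; apply: nc; exists c.
have F0E (c : set_type D) : F0 (rep (val c)) = f c by exact: F0f.
(* For Lip f = +oo the bound is +oo, so the arbitrary extension [F0 \o rep] will do. *)
case Lf : (Lip f) => [l| |]; last first.
- by have := Lip_ge0 f; rewrite Lf.
- exists (F0 \o rep); split; first exact: F0E.
  by rewrite gt0_muley ?lte_fin// leey.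
have l0 : 0 <= l by have := Lip_ge0 f; rewrite Lf lee_fin.
have F0_lip z z' : D' z -> D' z' -> `|F0 z - F0 z'| <= l * Lfun_norm (z - z').
  move=> [x Dx <-] [y Dy <-].
  have := Lip_bound Lf (exist _ x (mem_set Dx)) (exist _ y (mem_set Dy)).
  by rewrite -!F0E.
have [F [FF0 FL]] := doubling_extension (Lfun_norm_seminorm (lebesgue01 R) p1)
  (L2_inner_psd (lebesgue01 R) h2) p2
  (@mazur_map_lip _ _ _ _ _ p2 _ h2) (@mazur_map_shrink _ _ _ _ _ p2 _ h2)
  D'0 lam2 dbl' l0 F0_lip.
exists (F \o rep); split=> [c|].
  by rewrite /= FF0 ?F0E//; exists (val c) => //; exact: set_valP.
rewrite -EFinM; apply: Lip_le => [|x y]; first by rewrite mulr_ge0// ltW.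
exact: FL.
Qed.
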